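(* Let $\mathbb{K}$ be a field, $S=\mathbb{K}[x_1,\ldots,x_n]$, and let $I\subseteq S$ be a monomial ideal satisfying at least one of the following: (1) $\mathcal{F}(I)=\mathcal{F}(\sqrt{I})$ and the simplicial complex $\Delta(I)$ associated to $I$ is a simplicial forest; (2) $I$ is a support-$3$ monomial ideal. Then the Mendez--Pinto--Villarreal conjecture holds for $I$, that is: if $I$ has no embedded associated primes, the irreducible decomposition of $I$ is minimal, and $I$ is a Simis ideal, then there exist a square-free monomial ideal $J\subseteq S$ which is a Simis ideal and a standard linear weighting $w=(w_1,\ldots,w_n)$ such that $I=J_w$.
   Context: Notation: for a monomial $\mathbf{x}^{\mathbf{a}}=x_1^{a_1}\cdots x_n^{a_n}$, $\operatorname{supp}(\mathbf{x}^{\mathbf{a}})=\{x_i\mid a_i\neq 0\}$. $\mathcal{G}(I)$ is the unique minimal monomial generating set of $I$, and $\mathcal{F}(I)=\{\operatorname{supp}(\mathbf{x}^{\mathbf{a}})\mid \mathbf{x}^{\mathbf{a}}\in\mathcal{G}(I)\}$. The condition $\mathcal{F}(I)=\mathcal{F}(\sqrt I)$ is equivalent to there being no proper containment among the supports of the minimal generators; in that case $\Delta(I)$ denotes the simplicial complex on the variables whose set of facets is $\mathcal{F}(I)$. Symbolic powers: $I^{(s)}=\bigcap_{P\in\operatorname{MinAss}(I)}(I^sS_P\cap S)$ for $s\ge 1$, where $\operatorname{MinAss}(I)$ is the set of minimal primes of $I$. $I$ is a Simis ideal if $I^{(s)}=I^s$ for all $s\ge 1$. Irreducible decomposition: irreducible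 monomial ideals are those generated by powers of distinct variables. Every monomial ideal has a unique irredundant decomposition as an intersection of irreducible monomial ideals (its irreducible decomposition). It is called minimal if it is a minimal primary decomposition, i.e. distinct components have distinct radicals. Weightings: a standard linear weighting $w=(w_1,\ldots,w_n)$ assigns a positive integer $w_i$ to each variable $x_i$; for a monomial ideal $J$, $J_w$ is the ideal generated by the monomials $x_1^{w_1a_1}\cdots x_n^{w_na_n}$ with $x_1^{a_1}\cdots x_n^{a_n}\in\mathcal{G}(J)$. A support-$3$ monomial ideal is a monomial ideal all of whose minimal generators have the form $x_i^ax_j^bx_k^c$ with $i,j,k$ distinct and $a,b,c\ge 1$. Simplicial forests: let $\Delta$ be a simplicial complex with facet set $\mathcal{F}(\Delta)$. A facet $F$ is a leaf if either $F$ is the only facet, or there is a facet $G\neq F$ such that $H\cap F\subseteq G\cap F$ for every facet $H\neq F$. A subcomplex of $\Delta$ here means a simplicial complex $\Delta'$ with $\mathcal{F}(\Delta')\subseteq\mathcal{F}(\Delta)$. A connected simplicial complex is a simplicial tree if every non-empty subcomplex has a leaf; a simplicial forest is a simplicial complex whose connected components are simplicial trees. *)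

(* Defs.v *)
From HB Require Import structures.
From mathcomp Require Import all_boot all_order all_algebra.
From mathcomp Require Import mpoly.

Set Implicit Arguments.
Unset Strict Implicit.
Unset Printing Implicit Defensive.

Import GRing.Theory.
Local Open Scope ring_scope.

(* Ideals are Prop-valued predicates, compared extensionally by [same_set]. *)

Definition same_set (T : Type) (A B : T -> Prop) : Prop :=
  forall x, A x <-> B x.

Definition subset_of (T : Type) (A B : T -> Prop) : Prop :=
  forall x, A x -> B x.

Definition is_ideal (R : comNzRingType) (I : R -> Prop) : Prop :=
  [/\ I 0, (forall x y, I x -> I y -> I (x + y))
    & (forall a x, I x -> I (a * x))].

(* Finite sums of products c * g with c in C and g in A: when C is a subring,
   this is the C-submodule generated by A. *)
Definition span_over (R : comNzRingType) (C A : R -> Prop) (f : R) : Prop :=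
  exists s : seq (R * R),
    (forall p, p \in s -> C p.1 /\ A p.2) /\ f = \sum_(p <- s) p.1 * p.2.

Definition ideal_gen (R : comNzRingType) (A : R -> Prop) : R -> Prop :=
  span_over (fun _ => True) A.

Definition ideal_pow (R : comNzRingType) (I : R -> Prop) (s : nat) : R -> Prop :=
  ideal_gen (fun f => exists g : 'I_s -> R,
    (forall i, I (g i)) /\ f = \prod_(i < s) g i).

Definition radical (R : comNzRingType) (I : R -> Prop) (f : R) : Prop :=
  exists k : nat, I (f ^+ k).

Definition prime_ideal (R : comNzRingType) (P : R -> Prop) : Prop :=
  [/\ is_ideal P, ~ P 1 & (forall x y, P (x * y) -> P x \/ P y)].

Definition minimal_prime (R : comNzRingType) (I P : R -> Prop) : Prop :=
  [/\ prime_ideal P, subset_of I P &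
      forall Q, prime_ideal Q -> subset_of I Q -> subset_of Q P ->
        same_set Q P].

(* P is the annihilator of the class of some f in R / I. *)
Definition associated_prime (R : comNzRingType) (I P : R -> Prop) : Prop :=
  prime_ideal P /\ exists f : R, same_set P (fun g => I (g * f)).

Definition no_embedded_primes (R : comNzRingType) (I : R -> Prop) : Prop :=
  forall P, associated_prime I P -> minimal_prime I P.

(* The localization of the domain R at the prime P, as a subring of the
   fraction field of R. *)
Definition localization (R : idomainType) (P : R -> Prop)
    (z : {fraction R}) : Prop :=
  exists a u : R, ~ P u /\ z = FracField.tofrac a / FracField.tofrac u.

Definition extension (R : idomainType) (P I : R -> Prop) :
    {fraction R} -> Prop :=
  span_over (localization P)
    (fun z => exists g, I g /\ z = FracField.tofrac g).

Definition symbolic_power (R : idomainType) (I : R -> Prop) (s : nat)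
    (f : R) : Prop :=
  forall P, minimal_prime I P ->
    extension P (ideal_pow I s) (FracField.tofrac f).

Definition Simis (R : idomainType) (I : R -> Prop) : Prop :=
  forall s : nat, (1 <= s)%N -> same_set (symbolic_power I s) (ideal_pow I s).

Definition monomial_gen (K : fieldType) (n : nat) (A : 'X_{1..n} -> Prop) :
    {mpoly K[n]} -> Prop :=
  ideal_gen (fun f : {mpoly K[n]} => exists m, A m /\ f = 'X_[m]).

Definition monomial_ideal (K : fieldType) (n : nat)
    (I : {mpoly K[n]} -> Prop) : Prop :=
  exists A : 'X_{1..n} -> Prop, same_set I (monomial_gen A).

Definition minimal_monomial_gens (K : fieldType) (n : nat)
    (I : {mpoly K[n]} -> Prop) (A : 'X_{1..n} -> Prop) : Prop :=
  same_set I (monomial_gen A) /\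
  forall B, subset_of B A -> same_set I (monomial_gen B) -> same_set B A.

(* For a monomial ideal the minimal set of monomial generators exists and is
   unique, so this is membership in that set. *)
Definition min_gens (K : fieldType) (n : nat) (I : {mpoly K[n]} -> Prop)
    (m : 'X_{1..n}) : Prop :=
  exists A, minimal_monomial_gens I A /\ A m.

(* Variables are identified with their indices. *)
Definition mnm_supp (n : nat) (m : 'X_{1..n}) : {set 'I_n} :=
  [set i | m i != 0%N].

Definition gen_supports (K : fieldType) (n : nat) (I : {mpoly K[n]} -> Prop)
    (F : {set 'I_n}) : Prop :=
  exists m, min_gens I m /\ F = mnm_supp m.

Definition support3_ideal (K : fieldType) (n : nat)
    (I : {mpoly K[n]} -> Prop) : Prop :=
  monomial_ideal I /\
  forall m, min_gens I m ->
    exists (i j k : 'I_n) (a b c : nat),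
      [/\ uniq [:: i; j; k], [&& 1 <= a, 1 <= b & 1 <= c]%N &
          m = (U_(i) *+ a + U_(j) *+ b + U_(k) *+ c)%MM].

Definition squarefree_monomial_ideal (K : fieldType) (n : nat)
    (J : {mpoly K[n]} -> Prop) : Prop :=
  monomial_ideal J /\ forall m, min_gens J m -> forall i, (m i <= 1)%N.

(* The zero ideal is included, as A = set0. *)
Definition irreducible_monomial_ideal (K : fieldType) (n : nat)
    (Q : {mpoly K[n]} -> Prop) : Prop :=
  exists (A : {set 'I_n}) (b : 'I_n -> nat),
    (forall i, i \in A -> (1 <= b i)%N) /\
    same_set Q (ideal_gen (fun f : {mpoly K[n]} =>
      exists2 i, i \in A & f = 'X_i ^+ b i)).

(* The intersection of the empty family is the unit ideal. *)
Definition irreducible_decomposition (K : fieldType) (n : nat)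
    (I : {mpoly K[n]} -> Prop) (r : nat)
    (Q : 'I_r -> {mpoly K[n]} -> Prop) : Prop :=
  [/\ forall j, irreducible_monomial_ideal (Q j),
      same_set I (fun f => forall j, Q j f) &
      forall j, ~ same_set I (fun f => forall i, i != j -> Q i f)].

(* The irreducible decomposition of a monomial ideal is unique up to order,
   so it does not matter that it is quantified existentially. *)
Definition minimal_irreducible_decomposition (K : fieldType) (n : nat)
    (I : {mpoly K[n]} -> Prop) : Prop :=
  exists (r : nat) (Q : 'I_r -> {mpoly K[n]} -> Prop),
    irreducible_decomposition I Q /\
    forall i j, i != j -> ~ same_set (radical (Q i)) (radical (Q j)).

Definition weighted_ideal (K : fieldType) (n : nat) (w : 'I_n -> nat)
    (J : {mpoly K[n]} -> Prop) : {mpoly K[n]} -> Prop :=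
  monomial_gen (fun m => exists a,
    min_gens J a /\ m = [multinom (w i * a i)%N | i < n]).

(* Simplicial complexes on the finite set T are given by their faces; not
   every point of T has to be a face. *)

Definition simplicial_complex (T : finType) (D : {set {set T}}) : bool :=
  [forall F in D, forall G : {set T}, (G \subset F) ==> (G \in D)].

Definition facets (T : finType) (D : {set {set T}}) : {set {set T}} :=
  [set F in D | [forall G in D, (F \subset G) ==> (G == F)]].

Definition subcomplex (T : finType) (D' D : {set {set T}}) : bool :=
  simplicial_complex D' && (facets D' \subset facets D).

Definition leaf (T : finType) (D : {set {set T}}) (F : {set T}) : bool :=
  (F \in facets D) &&
  ((facets D == [set F]) ||
   [exists G in facets D, (G != F) &&
     [forall H in facets D, (H != F) ==> (H :&: F \subset G :&: F)]]).

(* Any two facets are joined by a chain of facets in which consecutive ones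
   intersect. *)
Definition connected_complex (T : finType) (D : {set {set T}}) : bool :=
  let adj := [rel F G | [&& F \in facets D, G \in facets D
                          & F :&: G != set0]] in
  [forall F in facets D, forall G in facets D, connect adj F G].

Definition simplicial_tree (T : finType) (D : {set {set T}}) : Prop :=
  [/\ simplicial_complex D, connected_complex D &
      forall D', subcomplex D' D -> D' != set0 -> exists F, leaf D' F].

Definition connected_component (T : finType) (D C : {set {set T}}) : bool :=
  maxset (fun C' => [&& subcomplex C' D, C' != set0 & connected_complex C']) C.

Definition simplicial_forest (T : finType) (D : {set {set T}}) : Prop :=
  simplicial_complex D /\
  forall C, connected_component D C -> simplicial_tree C.

(* D is the simplicial complex on the variables with facet set F(I); it is
   determined by I, a complex being determined by its facets. *)
Definition is_Delta (K : fieldType) (n : nat) (I : {mpoly K[n]} -> Prop)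
    (D : {set {set 'I_n}}) : Prop :=
  simplicial_complex D /\ forall F, F \in facets D <-> gen_supports I F.

(* Main.v *)
Require Import Defs.
From HB Require Import structures.
From mathcomp Require Import all_boot all_order all_algebra.
From mathcomp Require Import mpoly.
From mathcomp Require Import zify.
From Stdlib Require Import Classical.

Set Implicit Arguments.
Unset Strict Implicit.
Unset Printing Implicit Defensive.

Import Order.TTheory GRing.Theory Num.Theory.

(** Write the irreducible decomposition of I as the intersection of the ideals
    Q_j generated by the powers x_i^(b_j i), i in C_j. Since no prime is embedded,
    the C_j form an antichain (components_antichain), the minimal primes are the
    ideals generated by the variables of one C_j, and a monomial x^m lies in the
    s-th symbolic power as soon as, for every j, the integer parts of
    m_i / b_j i, summed over i in C_j, add up to at least s
    (symbolic_power_monomial). It is enough to prove that each variable occurs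
    with one and the same exponent w_i in all the minimal generators that
    involve it.

    The Simis hypothesis enters only through Simis_exchange. Suppose that two
    generators g, g' have different positive exponents in x_l. No Q_j with l in
    C_j can be tight at both, where tight means that the sum of g_i / b_j i over
    C_j is 1: tightness with g_l > 0 forces g_l = b_j l. Hence for a
    suitable N the monomial x^(N (g + g')) / x_l still lies in the symbolic power
    of exponent 2N, so it is divisible by a product of 2N generators. Geometrically,
    slightly below the midpoint of g and g' there is still a point of the Newton
    polyhedron. So g and g' cannot be the only minimizers, among the generators
    supported in the union of their supports, of a linear form (edge_consistent),
    nor minimizers of a form with positive coefficient at l (face_consistent).

    In both cases the supports of the generators form an antichain; then a support
    determines its generator (unique_generator), and for conflicting g and g' a
    suitable linear form is found. If the supports differ by the exchange of a
    single element, a lower edge of the planar projection to the two exchanged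
    coordinates provides it (consistent_exchange_one). This settles 3-element
    supports sharing two elements; if they share only l, the form that weighs each
    other variable by the inverse of its exponent in g or g' works, as any other
    generator in the union shares two elements with g or g'
    (support_three_consistent). For a forest, the facets inside the union of the
    two supports have a leaf, which must be one of the two. If its joint is the
    other one, the union contains no third facet; otherwise the joint reduces the
    claim to smaller unions (forest_consistent).

    Once the exponents w_i are found, I = J_w with J generated by the products of
    the variables in each support, and the substitution of x_i^(w_i) for x_i
    transports the Simis property from I to J (support_ideal_Simis). *)

(** * Generators with conflicting exponents *)

Lemma exists_min d (O : orderType d) (T : eqType) (s : seq T) (P : T -> Prop)
    (f : T -> O) :
  (forall x, P x -> x \in s) -> (exists x, P x) ->
  exists x, P x /\ forall y, P y -> (f x <= f y)%O.
Proof.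
elim: s P => [|a s IH] P Ps [x Px]; first by have := Ps x Px.
have [[y [Py ya]]|no] := classic (exists y, P y /\ y <> a); last first.
  have eqa z : P z -> z = a by move=> Pz; apply: NNPP => za; apply: no; exists z.
  by exists x; split=> // y Py; rewrite (eqa x Px) (eqa y Py).
have [z|z [[Pz za] minz]] := IH (fun z => P z /\ z <> a) _ (ex_intro _ y (conj Py ya)).
  by case=> /Ps; rewrite inE => /orP [/eqP|].
have [Pa|nPa] := classic (P a); last first.
  by exists z; split=> // t Pt; apply: minz; split=> // ta; apply: nPa; rewrite -ta.
have [fza|faz] := leP (f z) (f a).
  exists z; split=> // t Pt; have [->//|ta] := classic (t = a).
  exact: minz.
exists a; split=> // t Pt; have [->//|ta] := classic (t = a).
exact: le_trans (ltW faz) (minz _ (conj Pt ta)).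
Qed.

Definition wt n (phi : 'I_n -> nat) (m : 'X_{1..n}) : nat :=
  \sum_i phi i * m i.

Lemma in_mnm_supp n (m : 'X_{1..n}) i : (i \in mnm_supp m) = (0 < m i).
Proof. by rewrite inE lt0n. Qed.

(** A product of 2N monomials of G divides x^(N (g + g')) / x_l: the midpoint of
    g and g' is not on the boundary of the Newton polyhedron in direction l. *)
Definition average_below n (G : 'X_{1..n} -> Prop) (g g' : 'X_{1..n}) (l : 'I_n) :=
  exists (N : nat) (s : seq 'X_{1..n}),
    [/\ 0 < N, size s = N + N, forall h, h \in s -> G h &
        forall i, \sum_(h <- s) h i + (i == l) <= N * (g i + g' i)].

(** The second alternative also excludes that a linear constraint involving x_l
    is tight at g: it would force every h supported in the support of g
    to have exponent at least g l. It is used with g = g'. *)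
Definition exchange_property n (G : 'X_{1..n} -> Prop) :=
  forall g g' l, G g -> G g' -> l \in mnm_supp g -> l \in mnm_supp g' ->
    (g l <> g' l \/
     exists h, [/\ G h, mnm_supp h \subset mnm_supp g & h l < g l]) ->
    average_below G g g' l.

Definition support_antichain n (G : 'X_{1..n} -> Prop) :=
  forall g h, G g -> G h -> mnm_supp g \subset mnm_supp h ->
    mnm_supp g = mnm_supp h.

Definition divisibility_antichain n (G : 'X_{1..n} -> Prop) :=
  forall g h, G g -> G h -> (g <= h)%MM -> g = h.

Lemma sum_ge_size (T : eqType) (s : seq T) (f : T -> nat) mu :
  (forall x, x \in s -> mu <= f x) -> size s * mu <= \sum_(x <- s) f x.
Proof.
elim: s => [|a s IH] lo; first by rewrite mul0n.
rewrite big_cons /= mulSn leq_add ?lo ?inE ?eqxx //.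
by apply: IH => x xs; apply: lo; rewrite inE xs orbT.
Qed.

Lemma sum_eq_min (T : eqType) (s : seq T) (f : T -> nat) mu :
  (forall x, x \in s -> mu <= f x) -> \sum_(x <- s) f x <= size s * mu ->
  forall x, x \in s -> f x = mu.
Proof.
elim: s => [|a s IH] // lo; rewrite big_cons /= => hi.
have fa : mu <= f a by apply: lo; rewrite inE eqxx.
have los x : x \in s -> mu <= f x by move=> xs; apply: lo; rewrite inE xs orbT.
have := sum_ge_size los => lo_s x; rewrite inE => /orP [/eqP->|]; first lia.
by apply: IH => //; lia.
Qed.

Section Consistency.
Variables (n : nat) (G : 'X_{1..n} -> Prop).
Hypothesis exchange : exchange_property G.
Hypothesis antichain : support_antichain G.
Hypothesis minimal : divisibility_antichain G.
Hypothesis finite : exists s : seq 'X_{1..n}, forall g, G g -> g \in s.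

(** The next two lemmas are what an instance of average_below says about linear
    forms and about supports. *)
Lemma average_wt (g g' : 'X_{1..n}) l N (s : seq 'X_{1..n}) phi :
  (forall i, \sum_(h <- s) h i + (i == l) <= N * (g i + g' i)) ->
  \sum_(h <- s) wt phi h + phi l <= N * (wt phi g + wt phi g').
Proof.
move=> le_s; rewrite /wt exchange_big /= -big_split big_distrr /=.
have -> : phi l = \sum_i phi i * (i == l).
  rewrite (bigD1 l) //= eqxx muln1 big1 ?addn0 // => i /negbTE->.
  by rewrite muln0.
rewrite -big_split; apply: leq_sum => i _ /=.
rewrite -big_distrr /= -mulnDr -[X in _ <= _ * X]mulnDr mulnCA leq_mul2l.
by rewrite le_s orbT.
Qed.

Lemma average_supp (g g' : 'X_{1..n}) l N (s : seq 'X_{1..n}) (h : 'X_{1..n}) :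
  (forall i, \sum_(h <- s) h i + (i == l) <= N * (g i + g' i)) -> h \in s ->
  mnm_supp h \subset mnm_supp g :|: mnm_supp g'.
Proof.
move=> le_s hs; apply/subsetP => i; rewrite in_setU !in_mnm_supp => hi.
have := le_s i; rewrite (big_rem h) //=.
case: (posnP (g i)) => [->|//]; case: (posnP (g' i)) => [->|//].
by rewrite muln0; lia.
Qed.

(** A conflict at l would give 2N generators whose total weight is less than
    2N times the minimum, by at least phi l. *)
Lemma face_consistent (phi : 'I_n -> nat) g g' l :
  G g -> G g' -> wt phi g = wt phi g' ->
  (forall h, G h -> mnm_supp h \subset mnm_supp g :|: mnm_supp g' ->
     wt phi g <= wt phi h) ->
  0 < phi l -> l \in mnm_supp g -> l \in mnm_supp g' -> g l = g' l.
Proof.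
move=> Gg Gg' eq_wt min_wt phil lg lg'; apply: NNPP => ne.
have [N [s [N0 szs Gs le_s]]] := exchange Gg Gg' lg lg' (or_introl ne).
have := average_wt phi le_s; rewrite -eq_wt.
suff : size s * wt phi g <= \sum_(h <- s) wt phi h by rewrite szs; nia.
by apply: sum_ge_size => h hs; apply: min_wt (Gs h hs) (average_supp le_s hs).
Qed.

Lemma sum_of_two (s : seq 'X_{1..n}) (g g' : 'X_{1..n}) :
  (forall h, h \in s -> h = g \/ h = g') ->
  exists a b, a + b = size s /\
    forall i, \sum_(h <- s) h i = a * g i + b * g' i.
Proof.
elim: s => [|h s IH] two; first by exists 0, 0; split=> // i; rewrite big_nil.
have [|a [b [eq_sz eq_s]]] := IH; first by move=> k ks; apply: two; rewrite inE ks orbT.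
have [->|->] : h = g \/ h = g' by apply: two; rewrite inE eqxx.
  by exists a.+1, b; split=> [|i]; rewrite ?big_cons ?eq_s /=; lia.
by exists a, b.+1; split=> [|i]; rewrite ?big_cons ?eq_s /=; lia.
Qed.

(** Here phi may vanish at l. After a conflict, the 2N generators all have minimal
    weight, so they are copies of g and g'. An element of the support of g
    outside that of g' allows at most N copies of g; symmetrically for g'.
    So both occur N times, which leaves no room to lower the exponent of x_l. *)
Lemma edge_consistent (phi : 'I_n -> nat) g g' l :
  G g -> G g' -> wt phi g = wt phi g' ->
  (forall h, G h -> mnm_supp h \subset mnm_supp g :|: mnm_supp g' ->
     wt phi g < wt phi h \/ h = g \/ h = g') ->
  mnm_supp g != mnm_supp g' ->
  l \in mnm_supp g -> l \in mnm_supp g' -> g l = g' l.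
Proof.
move=> Gg Gg' eq_wt min_wt /eqP ne_supp lg lg'; apply: NNPP => ne.
have [N [s [N0 szs Gs le_s]]] := exchange Gg Gg' lg lg' (or_introl ne).
have lo h : h \in s -> wt phi g <= wt phi h.
  move=> hs; have := min_wt h (Gs h hs) (average_supp le_s hs).
  by case=> [/ltnW//|[->|->]] //; rewrite eq_wt.
have hi : \sum_(h <- s) wt phi h <= size s * wt phi g.
  by have := average_wt phi le_s; rewrite -eq_wt szs; lia.
have [|a [b [ab eq_s]]] := @sum_of_two s g g'.
  move=> h hs; have := sum_eq_min lo hi hs.
  by case: (min_wt h (Gs h hs) (average_supp le_s hs)) => // lt eq; lia.
have /subsetPn [i ig ig'] : ~~ (mnm_supp g \subset mnm_supp g').
  by apply/negP => /(antichain Gg Gg').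
have /subsetPn [k kg' kg] : ~~ (mnm_supp g' \subset mnm_supp g).
  by apply/negP => /(antichain Gg' Gg) /esym.
have aN : a <= N.
  have := le_s i; rewrite eq_s; move: ig ig'; rewrite !in_mnm_supp -leqNgt leqn0.
  by move=> gi /eqP->; case: (i == l) => /=; nia.
have bN : b <= N.
  have := le_s k; rewrite eq_s; move: kg' kg; rewrite !in_mnm_supp -leqNgt leqn0.
  by move=> gk /eqP->; case: (k == l) => /=; nia.
have [eq_a eq_b] : a = N /\ b = N by lia.
by have := le_s l; rewrite eq_s eqxx eq_a eq_b mulnDr addn1 ltnn.
Qed.

(** Let g0 have least degree among the generators with a given support. Any other
    h with this support is smaller than g0 in some x_l, so x^(2N g0) / x_l would be
    divisible by a product of 2N generators with this support, all of degree
    at least that of g0. *)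
Lemma unique_generator g g' : G g -> G g' -> mnm_supp g = mnm_supp g' -> g = g'.
Proof.
move=> Gg Gg' eq_supp.
have [s Gs] := finite.
have [||g0 [[Gg0 supp0] min0]] := @exists_min _ nat _ s
    (fun h => G h /\ mnm_supp h = mnm_supp g) (wt (fun _ => 1)).
  by move=> h [/Gs].
  by exists g.
suff all_g0 h : G h -> mnm_supp h = mnm_supp g -> h = g0.
  by rewrite (all_g0 g) // (all_g0 g').
move=> Gh supph; apply: NNPP => ne.
have [l ltl] : exists l, h l < g0 l.
  apply: NNPP => no; apply: ne; apply/esym/minimal => //; apply/mnm_lepP => i.
  by rewrite leqNgt; apply/negP => lti; apply: no; exists i.
have lg0 : l \in mnm_supp g0 by rewrite in_mnm_supp; lia.
have [|N [t [N0 szt Gt le_t]]] := exchange Gg0 Gg0 lg0 lg0.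
  by right; exists h; rewrite supph supp0; split.
have := average_wt (fun _ => 1) le_t.
suff : size t * wt (fun _ => 1) g0 <= \sum_(k <- t) wt (fun _ => 1) k.
  by rewrite szt; lia.
apply: sum_ge_size => k kt; apply: min0; split; first exact: Gt.
rewrite -supp0; apply: antichain; [exact: Gt|by []|].
by have := average_supp le_t kt; rewrite setUid.
Qed.

Lemma eq_generator g h : G g -> G h -> mnm_supp h \subset mnm_supp g -> h = g.
Proof. by move=> Gg Gh sub; apply: unique_generator => //; apply: antichain. Qed.

Lemma wt_two (e f : 'I_n) a b (m : 'X_{1..n}) : e != f ->
  wt (fun i => if i == e then a else if i == f then b else 0) m =
  a * m e + b * m f.
Proof.
move=> ef; have fe : f != e by rewrite eq_sym.
rewrite /wt (bigD1 e) //= eqxx (bigD1 f) //= (negbTE fe) eqxx big1 ?addn0 //.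
by move=> i /andP [/negbTE-> /negbTE->].
Qed.

(** Project the generators supported in the union U of the two supports to the
    coordinates e and f. Then g and g' are the only ones on the axes, at
    (g e, 0) and (0, g' f). Let h0 be the other end of the edge of the
    lower hull that starts at g, found by minimizing the slope. If h0 involved e,
    face_consistent with the form supporting that edge would give h0 e = g e; so
    h0 = g', and g, g' are the two ends of an edge. By face_consistent again
    no other generator projects to that edge. *)
Lemma consistent_exchange_one g g' e f :
  G g -> G g' -> mnm_supp g :\: mnm_supp g' = [set e] ->
  mnm_supp g' :\: mnm_supp g = [set f] ->
  forall l, l \in mnm_supp g -> l \in mnm_supp g' -> g l = g' l.
Proof.
move=> Gg Gg' Dgg' Dg'g.
have /setDP [eg eg'] : e \in mnm_supp g :\: mnm_supp g' by rewrite Dgg' set11.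
have /setDP [fg' fg] : f \in mnm_supp g' :\: mnm_supp g by rewrite Dg'g set11.
have ef : e != f by apply: contraNneq fg => <-.
have g'e : g' e = 0 by apply/eqP; move: eg'; rewrite in_mnm_supp -eqn0Ngt.
have gf : g f = 0 by apply/eqP; move: fg; rewrite in_mnm_supp -eqn0Ngt.
move: (eg) (fg'); rewrite !in_mnm_supp => c0 d0.
pose U := mnm_supp g :|: mnm_supp g'.
have only_g h : G h -> mnm_supp h \subset U -> h f = 0 -> h = g.
  move=> Gh /subsetP hU hf; apply: eq_generator => //; apply/subsetP => i hi.
  have := hU i hi; rewrite in_setU => /orP [//|ig']; apply: contraLR hi => ig.
  have : i \in mnm_supp g' :\: mnm_supp g by apply/setDP.
  by rewrite Dg'g => /set1P->; rewrite in_mnm_supp hf.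
have only_g' h : G h -> mnm_supp h \subset U -> h e = 0 -> h = g'.
  move=> Gh /subsetP hU he; apply: eq_generator => //; apply/subsetP => i hi.
  have := hU i hi; rewrite in_setU => /orP [ig|//]; apply: contraLR hi => ig'.
  have : i \in mnm_supp g :\: mnm_supp g' by apply/setDP.
  by rewrite Dgg' => /set1P->; rewrite in_mnm_supp he.
have subU h : mnm_supp h \subset U -> mnm_supp g :|: mnm_supp h \subset U.
  by move=> hU; rewrite subUset hU subsetUl.
have [s Gs] := finite.
pose slope (h : 'X_{1..n}) : rat := (((h e)%:R - (g e)%:R) / (h f)%:R)%R.
have [||h0 [[Gh0 h0U h0f] min0]] := @exists_min _ rat _ s
    (fun h => [/\ G h, mnm_supp h \subset U & 0 < h f]) slope.
- by move=> h [/Gs].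
- by exists g'; split; rewrite ?subsetUr.
have low h : G h -> mnm_supp h \subset U ->
    g e * h0 f + h0 e * h f <= h0 f * h e + g e * h f.
  move=> Gh hU; case: (posnP (h f)) => [hf|hf].
    by rewrite (only_g h) // gf; lia.
  have := min0 h (And3 Gh hU hf).
  rewrite /slope ler_pdivrMr ?ltr0n // mulrAC ler_pdivlMr ?ltr0n //.
  rewrite !mulrBl lerBlDr addrAC lerBrDr -!natrM -!natrD ler_nat; lia.
have h0e : h0 e < g e by have := low g' Gg' (subsetUr _ _); rewrite g'e; nia.
have eq_h0 : h0 = g'.
  apply: only_g' => //; apply/eqP; rewrite eqn0Ngt -in_mnm_supp; apply/negP => eh0.
  have := @face_consistent
    (fun i => if i == e then h0 f else if i == f then g e - h0 e else 0)
    g h0 e Gg Gh0.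
  rewrite !wt_two // eqxx gf => /(_ _ _ h0f eg eh0) neq.
  suff : g e = h0 e by lia.
  apply: neq; first nia.
  move=> h Gh hU; have := low h Gh (subset_trans hU (subU _ h0U)).
  by rewrite wt_two //; nia.
move: low; rewrite eq_h0 g'e => low.
move=> l; apply: (@edge_consistent
  (fun i => if i == e then g' f else if i == f then g e else 0)) => //.
- by rewrite !wt_two // g'e gf; lia.
- move=> h Gh hU; have := low h Gh hU; rewrite !wt_two // gf !muln0 mul0n !addn0.
  rewrite [g' f * g e]mulnC leq_eqVlt => /orP [/eqP eq_wt|]; last by left.
  right; case: (posnP (h e)) => [he|he]; first by right; apply: only_g'.
  have := @face_consistent
    (fun i => if i == e then g' f else if i == f then g e else 0)
    g h e Gg Gh.
  rewrite !wt_two // eqxx gf => /(_ _ _ d0 eg) eq_e.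
  left; apply: only_g => //; suff : g e = h e by nia.
  apply: eq_e; rewrite ?in_mnm_supp //; first nia.
  move=> k Gk kU; have := low k Gk (subset_trans kU (subU _ hU)).
  by rewrite wt_two //; nia.
- by apply: contraNneq eg' => <-.
Qed.

End Consistency.

(** * Three-element supports and forests *)

(** What the argument takes from a simplicial forest with set of facets S: the
    facets inside the union of E and F have a leaf. *)
Definition leaf_property (T : finType) (S : {set T} -> Prop) :=
  forall E F, S E -> S F -> E :&: F != set0 ->
  exists L, [/\ S L, L \subset E :|: F &
    (forall H, S H -> H \subset E :|: F -> H = L) \/
    exists J, [/\ S J, J \subset E :|: F, J != L &
      forall H, S H -> H \subset E :|: F -> H != L -> H :&: L \subset J]].

Section Cases.
Variables (n : nat) (G : 'X_{1..n} -> Prop).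
Hypothesis exchange : exchange_property G.
Hypothesis antichain : support_antichain G.
Hypothesis minimal : divisibility_antichain G.
Hypothesis finite : exists s : seq 'X_{1..n}, forall g, G g -> g \in s.

Let uniq_gen := unique_generator exchange antichain minimal finite.
Let eq_gen := eq_generator exchange antichain minimal finite.

Section SupportThree.
Hypothesis three : forall g, G g -> #|mnm_supp g| = 3.

Lemma consistent_share_two g h : G g -> G h -> #|mnm_supp g :&: mnm_supp h| = 2 ->
  forall l, l \in mnm_supp g -> l \in mnm_supp h -> g l = h l.
Proof.
move=> Gg Gh two.
have /cards1P [e De] : #|mnm_supp g :\: mnm_supp h| == 1.
  by have := cardsID (mnm_supp h) (mnm_supp g); rewrite two three //; lia.
have /cards1P [f Df] : #|mnm_supp h :\: mnm_supp g| == 1.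
  by have := cardsID (mnm_supp g) (mnm_supp h); rewrite setIC two three //; lia.
exact: (consistent_exchange_one exchange antichain minimal finite Gg Gh De Df).
Qed.

Lemma wt_supp (phi : 'I_n -> nat) m : wt phi m = \sum_(i in mnm_supp m) phi i * m i.
Proof.
rewrite /wt (bigID (mem (mnm_supp m))) /= addnC big1 // => i.
by rewrite in_mnm_supp -eqn0Ngt => /eqP->; rewrite muln0.
Qed.

(** The two common elements contribute L each, because h agrees with k there, and
    the third element of h contributes a positive amount. *)
Lemma heavy_generator (phi : 'I_n -> nat) L k h :
  G k -> G h -> #|mnm_supp k :&: mnm_supp h| = 2 ->
  (forall i, i \in mnm_supp k :&: mnm_supp h -> phi i * k i = L) ->
  (forall i, i \in mnm_supp h -> 0 < phi i) -> 2 * L < wt phi h.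
Proof.
move=> Gk Gh two eqL phi0.
have /set0Pn [e /setDP [eh ek]] : mnm_supp h :\: mnm_supp k != set0.
  rewrite -card_gt0; have := cardsID (mnm_supp k) (mnm_supp h).
  by rewrite setIC two three //; lia.
rewrite wt_supp (bigID (mem (mnm_supp k))) /=.
rewrite (eq_bigl (mem (mnm_supp k :&: mnm_supp h))); last first.
  by move=> i; rewrite /= in_setI andbC.
rewrite (eq_bigr (fun=> L)); last first.
  move=> i ikh; move: (ikh); rewrite -(eqL i ikh) /= => /setIP [ik ih].
  by rewrite (consistent_share_two Gk Gh two ik ih).
rewrite sum_nat_const two -[X in X < _]addn0 ltn_add2l.
by rewrite (bigD1 e) ?eh //= ltn_addr // muln_gt0 phi0 // -in_mnm_supp.
Qed.

(** If g and g' disagree at l then l is their only common element. Let phi be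
    proportional to 1 / g i or 1 / g' i off l, and 0 at l: both g and g' have weight
    2L. A third generator h inside the union either contains l, and then it has
    two elements in common with both g and g', so it links g l to g' l; or it
    avoids l, and then it shares two elements with one of them and weighs more. *)
Lemma support_three_consistent g g' l : G g -> G g' ->
  l \in mnm_supp g -> l \in mnm_supp g' -> g l = g' l.
Proof.
move=> Gg Gg' lg lg'; apply: NNPP => ne.
have ne_supp : mnm_supp g != mnm_supp g'.
  by apply/eqP => /(uniq_gen Gg Gg') eq; apply: ne; rewrite eq.
have cardI h k : G h -> G k -> mnm_supp h != mnm_supp k ->
    #|mnm_supp h :&: mnm_supp k| <= 2.
  move=> Gh Gk nhk; rewrite leqNgt -(three Gh); apply: contra nhk => le.
  apply/eqP/antichain => //; have <- : mnm_supp h :&: mnm_supp k = mnm_supp h.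
    by apply/eqP; rewrite eqEcard subsetIl.
  exact: subsetIr.
have capl : mnm_supp g :&: mnm_supp g' = [set l].
  have lI : l \in mnm_supp g :&: mnm_supp g' by rewrite inE lg.
  have le2 := cardI _ _ Gg Gg' ne_supp.
  apply/esym/eqP; rewrite eqEcard sub1set lI cards1 leqNgt; apply/negP => lt1.
  by apply: ne; apply: consistent_share_two => //; lia.
pose L := (\prod_i maxn 1 (g i) * \prod_i maxn 1 (g' i)).
have dvL i : i \in mnm_supp g -> g i %| L.
  rewrite in_mnm_supp => gi; apply: dvdn_mulr.
  by rewrite (bigD1 i) //= (maxn_idPr gi) dvdn_mulr.
have dvL' i : i \in mnm_supp g' -> g' i %| L.
  rewrite in_mnm_supp => gi; apply: dvdn_mull.
  by rewrite (bigD1 i) //= (maxn_idPr gi) dvdn_mulr.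
have L0 : 0 < L.
  by rewrite muln_gt0 !prodn_gt0 // => i; rewrite leq_max.
pose phi i := if i == l then 0 else
  if i \in mnm_supp g then L %/ g i else L %/ g' i.
have phig i : i \in mnm_supp g -> i != l -> phi i * g i = L.
  by move=> ig /negbTE il; rewrite /phi il ig divnK // dvL.
have phig' i : i \in mnm_supp g' -> i != l -> phi i * g' i = L.
  move=> ig' il; rewrite /phi (negbTE il) ifN ?divnK ?dvL' //.
  by apply: contra il => ig; rewrite -in_set1 -capl inE ig.
have phi0 i : i \in mnm_supp g :|: mnm_supp g' -> i != l -> 0 < phi i.
  move=> iU il; rewrite lt0n; apply/eqP => phii; move: L0.
  move: iU; rewrite in_setU => /orP [/phig/(_ il) | /phig'/(_ il)];
    by rewrite phii => <-.
have wtL k : G k -> l \in mnm_supp k -> 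
    (forall i, i \in mnm_supp k -> i != l -> phi i * k i = L) -> wt phi k = 2 * L.
  move=> Gk lk eqL; rewrite wt_supp (big_setD1 l) //= {1}/phi eqxx add0n.
  rewrite (eq_bigr (fun=> L)) => [|i /setD1P [il ik]]; last exact: eqL.
  rewrite sum_nat_const; congr (_ * L).
  by have := cardsD1 l (mnm_supp k); rewrite lk three // add1n => -[<-].
have wtg : wt phi g = 2 * L by apply: wtL.
have wtg' : wt phi g' = 2 * L by apply: wtL.
apply: (ne); apply: (@edge_consistent _ _ exchange antichain phi) => //.
  by rewrite wtg wtg'.
move=> h Gh hU; have [->|/eqP hg] := eqVneq h g; first by right; left.
have [->|/eqP hg'] := eqVneq h g'; first by right; right.
left; rewrite wtg.
have hgI : #|mnm_supp g :&: mnm_supp h| <= 2.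
  by apply: cardI => //; apply/eqP => /(uniq_gen Gg Gh) /esym.
have hg'I : #|mnm_supp g' :&: mnm_supp h| <= 2.
  by apply: cardI => //; apply/eqP => /(uniq_gen Gg' Gh) /esym.
have card_h : (mnm_supp g :&: mnm_supp h) :|: (mnm_supp g' :&: mnm_supp h) = mnm_supp h.
  by rewrite -setIUl; apply/setIidPr.
have card_cap : (mnm_supp g :&: mnm_supp h) :&: (mnm_supp g' :&: mnm_supp h) =
    [set l] :&: mnm_supp h.
  by rewrite -setIIl capl.
have := cardsU (mnm_supp g :&: mnm_supp h) (mnm_supp g' :&: mnm_supp h).
rewrite card_h card_cap three // => card_eq.
have [lh|lh] := boolP (l \in mnm_supp h).
  have c1 : #|[set l] :&: mnm_supp h| = 1.
    by rewrite (setIidPl _) ?sub1set // cards1.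
  have eq1 : g l = h l by apply: consistent_share_two => //; lia.
  have eq2 : g' l = h l by apply: consistent_share_two => //; lia.
  by case: ne; rewrite eq1 eq2.
have hl i : i \in mnm_supp h -> i != l by move=> ih; apply: contraNneq lh => <-.
have phih i : i \in mnm_supp h -> 0 < phi i.
  by move=> ih; apply: phi0; [apply: (subsetP hU)|apply: hl].
(* The two intersections cover the three elements of h. *)
have [two|two] : #|mnm_supp g :&: mnm_supp h| = 2 \/ #|mnm_supp g' :&: mnm_supp h| = 2.
  by lia.
- apply: (heavy_generator Gg Gh two) => // i /setIP [ig ih]; apply: phig => //.
  exact: hl.
- apply: (heavy_generator Gg' Gh two) => // i /setIP [ig ih]; apply: phig' => //.
  exact: hl.
Qed.

End SupportThree.

(** Induction on the size of the union of the two supports. The leaf L found inside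
    the union is one of them: otherwise L is covered by its intersections with
    the two, hence contained in its joint J, against the antichain property. Say
    L is the support of g; then J contains l, because g' meets g in l. If J is the
    support of g', all other supports in the union lie in that of g', so
    g and g' are alone. Otherwise the union of J with either support is
    strictly smaller, and the exponent of x_l is the same along g, J, g'. *)
Lemma forest_consistent :
  leaf_property (fun E => exists2 g, G g & E = mnm_supp g) ->
  forall g g' l, G g -> G g' -> l \in mnm_supp g -> l \in mnm_supp g' -> g l = g' l.
Proof.
move=> leafP g g'.
have [m le_m] := ubnP #|mnm_supp g :|: mnm_supp g'|.
elim: m g g' le_m => // m IH g g' le_m l Gg Gg' lg lg'.
wlog: g g' le_m Gg Gg' lg lg' / exists J, [/\ exists2 j, G j & J = mnm_supp j,
    J \subset mnm_supp g :|: mnm_supp g', J != mnm_supp g &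
    forall H, (exists2 h, G h & H = mnm_supp h) ->
      H \subset mnm_supp g :|: mnm_supp g' -> H != mnm_supp g ->
      H :&: mnm_supp g \subset J].
  move=> wl; have [|||L [[k Gk ->] kU]] := leafP (mnm_supp g) (mnm_supp g').
  - by exists g.
  - by exists g'.
  - by apply/set0Pn; exists l; rewrite inE lg.
  case=> [all_k|[J [SJ JU JL JP]]].
    rewrite (@uniq_gen g g') // (all_k (mnm_supp g)) ?subsetUl //; last by exists g.
    by rewrite (all_k (mnm_supp g')) ?subsetUr //; exists g'.
  have [eqg|/eqP neg] := eqVneq (mnm_supp k) (mnm_supp g).
    by move: JL JP; rewrite eqg => JL JP; apply: wl => //; exists J.
  have [eqg'|/eqP neg'] := eqVneq (mnm_supp k) (mnm_supp g').
    move: JL JP; rewrite eqg' => JL JP; apply/esym.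
    by apply: wl; rewrite // [mnm_supp g' :|: _]setUC //; exists J.
  have kJ : mnm_supp k \subset J.
    rewrite -(setIidPr kU) setIUl subUset; apply/andP; split; apply: JP.
    - by exists g.
    - exact: subsetUl.
    - by apply/eqP => /esym.
    - by exists g'.
    - exact: subsetUr.
    - by apply/eqP => /esym.
  case: SJ JL kJ => j Gj -> /eqP JL kJ.
  by case: JL; rewrite (antichain Gk Gj kJ).
case=> J [[j Gj ->] jU jg jP].
have [eqs|ne] := eqVneq (mnm_supp g) (mnm_supp g'); first by rewrite (uniq_gen Gg Gg' eqs).
have capj : mnm_supp g' :&: mnm_supp g \subset mnm_supp j.
  by apply: jP; [exists g'|apply: subsetUr|rewrite eq_sym].
have lj : l \in mnm_supp j by apply: (subsetP capj); rewrite inE lg' lg.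
have [eqj|nej] := eqVneq (mnm_supp j) (mnm_supp g').
  apply: (@edge_consistent _ _ exchange antichain (fun=> 0)) => //.
  move=> h Gh hU; right.
  have [eqh|neh] := eqVneq (mnm_supp h) (mnm_supp g); first by left; apply: uniq_gen.
  right; apply: eq_gen => //; rewrite -(setIidPl hU) setIUr subUset subsetIr andbT.
  by rewrite -eqj; apply: jP => //; exists h.
have smaller h : G h -> mnm_supp h \subset mnm_supp g :|: mnm_supp g' ->
    ~~ (mnm_supp g :|: mnm_supp g' \subset mnm_supp h :|: mnm_supp j) ->
    #|mnm_supp h :|: mnm_supp j| < m.
  move=> Gh hU nsub; rewrite -ltnS; apply: leq_trans le_m; rewrite ltnS.
  by apply: proper_card; rewrite properE subUset hU jU.
have gj : g l = j l.
  apply: IH => //; apply: smaller => //; first exact: subsetUl.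
  rewrite subUset subsetUl /=; apply: contra nej => sub; apply/eqP/esym.
  apply: antichain => //; rewrite -(setIidPl sub) setIUr subUset capj /=.
  exact: subsetIr.
rewrite gj; apply/esym; apply: IH => //; apply: smaller => //; first exact: subsetUr.
rewrite subUset subsetUl andbT; apply: contra jg => sub; apply/eqP/esym.
apply: antichain => //; rewrite -(setIidPl sub) setIUr subUset subsetIr andbT.
by rewrite setIC.
Qed.

End Cases.

(** * Leaves of simplicial forests *)

Section Forest.
Variable T : finType.
Implicit Types (D : {set {set T}}) (E F G H : {set T}).

Lemma facetP D F :
  reflect (F \in D /\ forall G, G \in D -> F \subset G -> G = F) (F \in facets D).
Proof.
rewrite inE; apply: (iffP andP) => -[FD maxF]; split=> //.
  by move=> G GD FG; apply/eqP; move/forall_inP: maxF => /(_ G GD) /implyP; apply.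
by apply/forall_inP => G GD; apply/implyP => FG; rewrite (maxF G).
Qed.

Lemma face_in_facet D G : G \in D -> exists2 F, F \in facets D & G \subset F.
Proof.
move=> GD; have [F /maxsetP [FD maxF] GF] := @maxset_exists _ (mem D) G GD.
by exists F => //; apply/facetP; split=> // H HD FH; apply: maxF.
Qed.

Definition generated_complex (W : {set {set T}}) : {set {set T}} :=
  [set H : {set T} | [exists G in W, H \subset G]].

Lemma mem_generated (W : {set {set T}}) H :
  reflect (exists2 G, G \in W & H \subset G) (H \in generated_complex W).
Proof.
rewrite inE; apply: (iffP existsP) => [[G /andP [GW HG]]|[G GW HG]]; exists G => //.
exact/andP.
Qed.

Lemma facets_generated D (W : {set {set T}}) :
  W \subset facets D -> facets (generated_complex W) = W.
Proof.
move=> /subsetP WD; apply/setP => H; apply/facetP/idP => [[/mem_generated [G GW HG] maxH]|HW].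
  by rewrite -(maxH G) //; apply/mem_generated; exists G.
split=> [|G /mem_generated [G' G'W GG'] HG]; first by apply/mem_generated; exists H.
have /facetP [_ maxH] := WD H HW; have /facetP [G'D _] := WD G' G'W.
apply/eqP; rewrite eqEsubset HG andbT -(maxH G') //.
exact: subset_trans HG GG'.
Qed.

Lemma generated_simplicial (W : {set {set T}}) : simplicial_complex (generated_complex W).
Proof.
apply/forall_inP => F /mem_generated [G GW FG]; apply/forallP => H; apply/implyP => HF.
by apply/mem_generated; exists G => //; apply: subset_trans HF FG.
Qed.

(** The facets inside the union of E and F all meet E or F, and E meets F, so they
    generate a connected subcomplex. It lies in a single connected component,
    which is a tree, and so it has a leaf. *)
Lemma forest_leaf_property D :
  simplicial_forest D -> leaf_property (fun F => F \in facets D).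
Proof.
move=> [_ trees] E F ED FD EF.
pose W := [set H in facets D | H \subset E :|: F].
have WD : W \subset facets D by apply/subsetP => H; rewrite inE => /andP [].
have facW := facets_generated WD.
have EW : E \in W by rewrite inE ED subsetUl.
have FW : F \in W by rewrite inE FD subsetUr.
have W_ne : generated_complex W != set0.
  by apply/set0Pn; exists E; apply/mem_generated; exists E.
have W_conn : connected_complex (generated_complex W).
  rewrite /connected_complex facW.
  set adj := (X in connect X).
  have adj_sym : connect_sym adj.
    by apply: sym_connect_sym => H K; rewrite /adj /= setIC andbCA.
  have adjE H K : H \in W -> K \in W -> H :&: K != set0 -> connect adj H K.
    by move=> HW KW HK; apply: connect1; rewrite /adj /= HW KW.
  have toE H : H \in W -> connect adj H E.
    move=> HW; move: (HW); rewrite inE => /andP [/facetP [_ maxH] HU].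
    have [HE|HE] := eqVneq (H :&: E) set0; last exact: adjE.
    have [HF|HF] := eqVneq (H :&: F) set0; last first.
      apply: (connect_trans (adjE H F HW FW HF)); apply: adjE => //.
      by rewrite setIC.
    have H0 : H = set0 by rewrite -(setIidPl HU) setIUr HE HF setU0.
    have E0 : E = H by apply: maxH; [case/facetP: ED|rewrite H0 sub0set].
    by move: EF; rewrite E0 H0 set0I eqxx.
  apply/forall_inP => H HW; apply/forall_inP => K KW.
  by apply: connect_trans (toE H HW) _; rewrite adj_sym toE.
have [|C Cmax WC] := @maxset_exists _
  (fun C => [&& subcomplex C D, C != set0 & connected_complex C])
  (generated_complex W) _.
  by rewrite W_ne W_conn /subcomplex generated_simplicial facW WD.
have : subcomplex C D by have /maxsetP [/and3P []] := Cmax.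
case/andP => _ /subsetP CD.
have [_ _ leafC] := trees C Cmax.
have [|L] := leafC (generated_complex W) _ W_ne.
  rewrite /subcomplex generated_simplicial facW; apply/subsetP => H HW.
  have /facetP [HD maxH] := subsetP WD H HW.
  apply/facetP; split=> [|G GC HG].
    by apply: (subsetP WC); apply/mem_generated; exists H.
  have [G' G'C GG'] := face_in_facet GC.
  apply/eqP; rewrite eqEsubset HG andbT -(maxH G') //.
    by case/facetP: (CD G' G'C).
  exact: subset_trans HG GG'.
rewrite /leaf facW => /andP [LW alt]; exists L; move: (LW).
rewrite inE => /andP [LD LU]; split=> //.
case/orP: alt => [/eqP eqW|/exists_inP [J JW /andP [JL /forall_inP JP]]].
  by left=> H HD HU; apply/set1P; rewrite -eqW inE HD.
right; exists J; move: JW; rewrite inE => /andP [JD JU]; split=> // H HD HU HL.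
have HW : H \in W by rewrite inE HD.
by have /implyP /(_ HL) /subset_trans := JP H HW; apply; apply: subsetIl.
Qed.
End Forest.

Local Open Scope ring_scope.

(** * Ideals, localization and monomial ideals *)

Section Ideals.
Variable R : comNzRingType.
Implicit Types (A I P : R -> Prop).

Lemma ideal_gen_ideal A : is_ideal (ideal_gen A).
Proof.
split=> [|x y [s [sA ->]] [t [tA ->]]|a x [s [sA ->]]].
- by exists [::]; rewrite big_nil.
- exists (s ++ t); rewrite big_cat; split=> // p.
  by rewrite mem_cat => /orP [/sA|/tA].
- exists [seq (a * p.1, p.2) | p <- s]; split=> [p /mapP [q /sA [_ Aq] ->]//|].
  by rewrite big_map big_distrr; apply: eq_bigr => p _; rewrite /= mulrA.
Qed.

Lemma mem_ideal_gen A g : A g -> ideal_gen A g.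
Proof.
move=> Ag; exists [:: (1, g)]; rewrite big_seq1 mul1r; split=> // p.
by rewrite inE => /eqP->.
Qed.

Lemma ideal_sum I (T : eqType) (s : seq T) (F : T -> R) : is_ideal I ->
  (forall x, x \in s -> I (F x)) -> I (\sum_(x <- s) F x).
Proof.
move=> [I0 ID _] IF; rewrite big_seq; elim/big_ind: _ => //.
Qed.

Lemma ideal_gen_min A I : is_ideal I -> subset_of A I -> subset_of (ideal_gen A) I.
Proof.
move=> idI AI x [s [sA ->]]; apply: ideal_sum => // p /sA [_ /AI].
by case: idI => _ _; apply.
Qed.

Lemma ideal_same_set A I : is_ideal I -> same_set A I -> is_ideal A.
Proof.
move=> [I0 ID IM] AI; split=> [|x y /AI Ix /AI Iy|a x /AI Ix]; apply/AI => //.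
  exact: ID.
exact: IM.
Qed.

Lemma prime_prod P (T : eqType) (s : seq T) (F : T -> R) : prime_ideal P ->
  P (\prod_(x <- s) F x) -> exists2 x, x \in s & P (F x).
Proof.
move=> [_ P1 PM]; elim: s => [|x s IH]; first by rewrite big_nil.
rewrite big_cons => /PM [Px|/IH [y ys Py]]; first by exists x; rewrite // inE eqxx.
by exists y; rewrite // inE ys orbT.
Qed.

Lemma prime_exp P x k : prime_ideal P -> P (x ^+ k) -> P x.
Proof.
move=> [_ P1 PM]; elim: k => [|k IH]; first by rewrite expr0.
by rewrite exprS => /PM [].
Qed.

Lemma mem_ideal_pow I (T : eqType) (t : seq T) (F : T -> R) :
  (forall x, x \in t -> I (F x)) -> ideal_pow I (size t) (\prod_(x <- t) F x).
Proof.
move=> IF; apply: mem_ideal_gen; exists (fun i => F (tnth (in_tuple t) i)).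
by split=> [i|]; [apply/IF/mem_tnth|rewrite [LHS]big_tnth].
Qed.

End Ideals.

Section Localization.
Variables (R : idomainType) (P A : R -> Prop).
Hypotheses (P_prime : prime_ideal P) (A_ideal : is_ideal A).

(** By clearing denominators: the extension of A contracts to the elements that
    some u outside P multiplies into A. *)
Lemma extension_tofrac f :
  extension P A (FracField.tofrac f) <-> exists2 u, ~ P u & A (u * f).
Proof.
have [[P0 _ PM] P1 Pprime] := P_prime; have [A0 AD AM] := A_ideal.
have neq0 u : ~ P u -> FracField.tofrac u != 0.
  by move=> Pu; rewrite tofrac_eq0; apply/eqP => u0; apply: Pu; rewrite u0.
split=> [[s [sA eqf]]|[u Pu Auf]]; last first.
  exists [:: (FracField.tofrac 1 / FracField.tofrac u, FracField.tofrac (u * f))].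
  split=> [p|].
    by rewrite inE => /eqP-> /=; split; [exists 1, u|exists (u * f)].
  by rewrite big_seq1 /= tofrac1 mul1r tofracM mulKf // neq0.
suff [u [y [Pu Ay]]] : exists u y, [/\ ~ P u, A y &
    FracField.tofrac u * \sum_(p <- s) p.1 * p.2 = FracField.tofrac y].
  rewrite -eqf -tofracM => /eqP; rewrite tofrac_eq => /eqP eqy.
  by exists u; rewrite ?eqy.
elim: s {eqf} sA => [|p s IH] sA.
  by exists 1, 0; rewrite big_nil mulr0 tofrac0; split.
have [|u [y [Pu Ay eqy]]] := IH.
  by move=> q qs; apply: sA; rewrite inE qs orbT.
have [|[a [v [Pv eqp1]]] [g [Ag eqp2]]] := sA p; first by rewrite inE eqxx.
exists (v * u), (u * a * g + v * y); split.
- by move=> /Pprime [].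
- by apply: AD; apply: AM.
- rewrite big_cons eqp1 eqp2 mulrDr !tofracM tofracD !tofracM -eqy.
  congr (_ + _); last by rewrite mulrA.
  by rewrite mulrA mulrAC [_ * (_ / _)]mulrC -!mulrA mulKf ?neq0 // mulrCA mulrA.
Qed.

End Localization.

Lemma pow_sub_symbolic (R : idomainType) (I : R -> Prop) s :
  subset_of (ideal_pow I s) (symbolic_power I s).
Proof.
move=> f If P [Pprime _ _]; apply/extension_tofrac => //.
  exact: ideal_gen_ideal.
by exists 1; rewrite ?mul1r //; case: Pprime.
Qed.

Section Monomials.
Variables (K : fieldType) (n : nat).
Implicit Types (I : {mpoly K[n]} -> Prop) (A U : 'X_{1..n} -> Prop).

Lemma ideal_monomials I f : is_ideal I ->
  (forall m, m \in msupp f -> I 'X_[m]) -> I f.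
Proof.
move=> idI If; rewrite [f]mpolyE; apply: ideal_sum => // m /If.
by rewrite -mul_mpolyC; case: idI => _ _; apply.
Qed.

Definition upward_closed U := forall m m', U m -> (m <= m')%MM -> U m'.

(** For an upward closed U this is the monomial ideal whose monomials are those
    in U. *)
Definition monomials_in U (f : {mpoly K[n]}) := forall m, m \in msupp f -> U m.

Lemma monomials_in_ideal U : upward_closed U -> is_ideal (monomials_in U).
Proof.
move=> Uup; split=> [m|f g Uf Ug m|a f Uf m].
- by rewrite mcoeff_msupp mcoeff0 eqxx.
- by move=> /msuppD_le; rewrite mem_cat => /orP [/Uf|/Ug].
- by move=> /msuppM_le /allpairsP [[m1 m2] /= [_ /Uf Um ->]]; apply: Uup Um (lem_addl _ _).
Qed.

Lemma monomials_inX U m : monomials_in U 'X_[m] <-> U m.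
Proof.
split=> [Um|Um m']; first by apply: Um; rewrite msuppX inE.
by rewrite msuppX inE => /eqP->.
Qed.

Lemma monomial_genE A f :
  monomial_gen A f <-> monomials_in (fun m => exists a, A a /\ (a <= m)%MM) f.
Proof.
split.
  apply: ideal_gen_min => [|g [a [Aa ->]]].
    apply: monomials_in_ideal => m m' [a [Aa am]] mm'; exists a; split=> //.
    exact: lepm_trans mm'.
  by apply/monomials_inX; exists a; split=> //; apply: lepm_refl.
move=> fA; apply: ideal_monomials; first exact: ideal_gen_ideal.
move=> m /fA [a [Aa am]]; rewrite -(submK am) mpolyXD.
have [_ _] := ideal_gen_ideal (fun f : {mpoly K[n]} => exists m, A m /\ f = 'X_[m]).
by apply; apply: mem_ideal_gen; exists a.
Qed.

Lemma monomial_idealP I : monomial_ideal I ->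
  [/\ is_ideal I, upward_closed (fun m => I 'X_[m]) &
      forall f, I f <-> monomials_in (fun m => I 'X_[m]) f].
Proof.
case=> A IA; have idI : is_ideal I by apply: ideal_same_set IA; apply: ideal_gen_ideal.
split=> // [m m' Im mm'|f].
  by rewrite -(submK mm') mpolyXD; case: idI => _ _; apply.
split=> [/IA/monomial_genE fA m /fA Am|]; last exact: ideal_monomials.
by apply/IA/monomial_genE/monomials_inX.
Qed.

Definition minimal_monomial I (m : 'X_{1..n}) :=
  I 'X_[m] /\ forall m', I 'X_[m'] -> (m' <= m)%MM -> m' = m.

Lemma minimal_monomial_below I m : I 'X_[m] ->
  exists2 g, minimal_monomial I g & (g <= m)%MM.
Proof.
have [d le_d] := ubnP (mdeg m); elim: d m le_d => // d IH m le_d Im.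
have [[k [Ik km ne]]|no] :=
    classic (exists k, [/\ I 'X_[k], (k <= m)%MM & k <> m]).
  have [|a mina ak] := IH k _ Ik.
    rewrite -ltnS; apply: leq_trans le_d; rewrite ltnS -(submK km) mdegD -[X in (X < _)%N]add0n.
    rewrite ltn_add2r lt0n mdeg_eq0; apply/eqP => k0; apply: ne.
    by rewrite -(submK km) k0 add0m.
  by exists a => //; apply: lepm_trans km.
exists m; last exact: lepm_refl.
by split=> // m' Im' m'm; apply: NNPP => ne; apply: no; exists m'.
Qed.

(** If m is in a minimal generating set A, a monomial of I strictly below m would
    be a multiple of some other a in A, and A without m would still generate. *)
Lemma min_gensP I m : monomial_ideal I -> min_gens I m <-> minimal_monomial I m.
Proof.
move=> Imon; have [idI Iup IE] := monomial_idealP Imon; split.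
  case=> A [[IA minA] Am]; split.
    by apply/IA/monomial_genE/monomials_inX; exists m; split=> //; apply: lepm_refl.
  move=> m' /IA/monomial_genE/monomials_inX [a [Aa am']] m'm.
  apply: NNPP => ne.
  have ne_am : a <> m.
    move=> eq; apply: ne; apply/mnmP => i; apply/eqP.
    by rewrite eqn_leq (mnm_lepP m'm) -eq (mnm_lepP am').
  have [] : ~ (A m /\ m <> m) by case.
  apply/(minA (fun k => A k /\ k <> m)) => // [k []//|f].
  split=> [/IA/monomial_genE fA|/monomial_genE fB].
    apply/monomial_genE => k /fA [c [Ac ck]].
    have [eqc|nec] := classic (c = m); last by exists c.
    exists a; do 2?split=> //; apply: lepm_trans am' _.
    by apply: lepm_trans m'm _; rewrite -eqc.
  by apply/IA/monomial_genE => k /fB [c [[Ac _] ck]]; exists c.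
move=> min_m; exists (minimal_monomial I); split=> //; split=> [f|B BA BI k].
  rewrite IE; split=> [If|/monomial_genE fA].
    by apply/monomial_genE => k /If /minimal_monomial_below [a]; exists a.
  by move=> k /fA [a [[Ia _] ak]]; apply: Iup ak.
split=> [/BA//|[Ik mink]].
have /IE If : monomials_in (fun m => I 'X_[m]) 'X_[k] by apply/monomials_inX.
have /BI/monomial_genE/monomials_inX [a [Ba ak]] := If.
by have [Ia _] := BA a Ba; rewrite -(mink a).
Qed.

Lemma min_gens_below I m : monomial_ideal I -> I 'X_[m] ->
  exists2 g, min_gens I g & (g <= m)%MM.
Proof.
move=> Imon /minimal_monomial_below [g ming gm].
by exists g => //; apply/min_gensP.
Qed.

(** x^m is a multiple of a product of s monomials of I. *)
Definition sum_of_monomials I s (m : 'X_{1..n}) :=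
  exists t : seq 'X_{1..n},
    [/\ size t = s, forall h, h \in t -> I 'X_[h] &
        forall i, (\sum_(h <- t) h i <= m i)%N].

Lemma ideal_powE I s f : monomial_ideal I ->
  ideal_pow I s f <-> monomials_in (sum_of_monomials I s) f.
Proof.
move=> Imon; have [idI Iup IE] := monomial_idealP Imon; split.
  apply: ideal_gen_min.
    apply: monomials_in_ideal => m m' [t [szt It le_t]] /mnm_lepP mm'.
    by exists t; split=> // i; apply: leq_trans (mm' i).
  move=> _ [g [Ig ->]]; elim: s g Ig => [|s IH] g Ig m.
    by rewrite big_ord0 => _; exists [::]; split=> // i; rewrite big_nil.
  rewrite big_ord_recl => /msuppM_le /allpairsP [[m1 m2] /= [m1g m2g ->]].
  have [|t [szt It le_t]] := IH (fun i => g (lift ord0 i)) _ m2 m2g.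
    by move=> i; apply: Ig.
  have /IE/(_ m1 m1g) Im1 := Ig ord0.
  exists (m1 :: t); split=> [|h|i]; first by rewrite /= szt.
    by rewrite inE => /orP [/eqP->//|/It].
  by rewrite big_cons mnmDE leq_add2l.
move=> fI; apply: ideal_monomials; first exact: ideal_gen_ideal.
move=> m /fI [t [szt It le_t]].
have le_tm : ((\sum_(h <- t) h)%MM <= m)%MM by apply/mnm_lepP => i; rewrite mnm_sumE.
rewrite -(submK le_tm) mpolyXD -mpolyX_prod -szt.
have [_ _ mul] : is_ideal (ideal_pow I (size t)) by apply: ideal_gen_ideal.
by apply/mul/mem_ideal_pow.
Qed.

End Monomials.

(** * Ideals generated by variables and by powers of variables *)

Section Decomposition.
Variables (K : fieldType) (n : nat).
Implicit Types (I P : {mpoly K[n]} -> Prop) (C : {set 'I_n}) (m : 'X_{1..n}).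

(** The ideal generated by the variables of C, described by its monomials. *)
Definition variable_prime C : {mpoly K[n]} -> Prop :=
  monomials_in (fun m => exists2 i, i \in C & (0 < m i)%N).

Lemma variable_prime_monomial C m :
  variable_prime C 'X_[m] <-> exists2 i, i \in C & (0 < m i)%N.
Proof. exact: monomials_inX. Qed.

(** Substituting 0 for the variables of C: an endomorphism with kernel
    variable_prime C, which is prime because polynomials form a domain. *)
Definition kill_variables C (f : {mpoly K[n]}) : {mpoly K[n]} :=
  f \mPo [tuple if i \in C then 0 else 'X_i | i < n].

Lemma kill_variablesX C m : kill_variables C 'X_[m] =
  if [exists i in C, (0 < m i)%N] then 0 else 'X_[m].
Proof.
rewrite /kill_variables comp_mpolyX; case: ifPn => [/exists_inP [i iC mi]|].
  by rewrite (bigD1 i) //= tnth_mktuple iC expr0n eqn0Ngt mi mul0r.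
rewrite negb_exists_in => /forall_inP avoid; rewrite [RHS]mpolyXE_id.
apply: eq_bigr => i _; rewrite tnth_mktuple; case: ifP => // iC.
by have := avoid i iC; rewrite -eqn0Ngt => /eqP->; rewrite !expr0.
Qed.

Lemma kill_variables_eq0 C f : kill_variables C f = 0 <-> variable_prime C f.
Proof.
have killE : kill_variables C f =
    \sum_(m <- msupp f) f@_m *: kill_variables C 'X_[m].
  by rewrite /kill_variables [LHS]comp_mpolyEX.
split=> [kill0 m mf|fC]; last first.
  rewrite killE big_seq big1 // => m /fC [i iC mi]; rewrite kill_variablesX.
  by rewrite ifT ?scaler0 //; apply/exists_inP; exists i.
apply/exists_inP; apply: contraT => avoid.
have : (kill_variables C f)@_m = f@_m.
  rewrite killE raddf_sum (bigD1_seq m) ?msupp_uniq //= mcoeffZ kill_variablesX.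
  rewrite (negbTE avoid) mcoeffX eqxx mulr1 big1 ?addr0 // => k km.
  rewrite mcoeffZ kill_variablesX; case: ifP => _; first by rewrite mcoeff0 mulr0.
  by rewrite mcoeffX (negbTE km) mulr0.
rewrite kill0 mcoeff0 => /esym/eqP; rewrite mcoeff_eq0.
by rewrite mf.
Qed.

Lemma variable_prime_prime C : prime_ideal (variable_prime C).
Proof.
split=> [||f g].
- apply: monomials_in_ideal => m m' [i iC mi] /mnm_lepP le_mm'.
  by exists i => //; apply: leq_trans mi _.
- move/kill_variables_eq0; rewrite /kill_variables comp_mpoly1.
  by move/eqP; rewrite oner_eq0.
- rewrite -!kill_variables_eq0 /kill_variables rmorphM => /eqP.
  by rewrite mulf_eq0 => /orP [] /eqP; [left|right].
Qed.

Lemma variable_prime_sub C P : prime_ideal P ->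
  (forall i, i \in C -> P 'X_i) -> subset_of (variable_prime C) P.
Proof.
move=> [idP _ _] PC f fC; apply: ideal_monomials => // m /fC [i iC mi].
have Ui : (U_(i) <= m)%MM by rewrite lep1mP -lt0n.
by rewrite -(submK Ui) mpolyXD; case: idP => _ _; apply; apply: PC.
Qed.

(** The ideal generated by the powers x_i^(b i), i in C. *)
Definition irreducible_component C (b : 'I_n -> nat) : {mpoly K[n]} -> Prop :=
  monomials_in (fun m => exists2 i, i \in C & (b i <= m i)%N).

Lemma irreducible_componentX C b m :
  irreducible_component C b 'X_[m] <-> exists2 i, i \in C & (b i <= m i)%N.
Proof. exact: monomials_inX. Qed.

Lemma irreducible_componentE (Q : {mpoly K[n]} -> Prop) :
  irreducible_monomial_ideal Q -> exists Cb : {set 'I_n} * ('I_n -> nat),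
    (forall i, i \in Cb.1 -> (0 < Cb.2 i)%N) /\
    same_set Q (irreducible_component Cb.1 Cb.2).
Proof.
move=> [C [b [b0 QE]]]; exists (C, b); split=> // f.
have le_power i m : ((U_(i) *+ b i)%MM <= m)%MM = (b i <= m i)%N.
  apply/mnm_lepP/idP => [/(_ i)|le_b k]; first by rewrite mulmnE mnm1E eqxx mul1n.
  by rewrite mulmnE mnm1E; case: eqP => [<-|_]; rewrite ?mul1n ?mul0n.
rewrite QE; set A := fun f : {mpoly K[n]} => _.
have -> : ideal_gen A f <->
    monomial_gen (fun m => exists2 i, i \in C & m = (U_(i) *+ b i)%MM) f.
  split; apply: ideal_gen_min; try exact: ideal_gen_ideal.
    move=> _ [i iC ->]; apply: mem_ideal_gen; exists (U_(i) *+ b i)%MM.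
    by split; [exists i|rewrite mpolyXn].
  move=> _ [_ [[i iC ->] ->]]; apply: mem_ideal_gen; exists i => //.
  by rewrite mpolyXn.
rewrite monomial_genE; split=> fE m /fE.
  by case=> _ [[i iC ->]]; rewrite le_power; exists i.
by case=> i iC le_b; exists (U_(i) *+ b i)%MM; rewrite le_power; split=> //; exists i.
Qed.

(** Pigeonhole: in a product of more than the sum of the b i monomials, each
    involving a variable of C, some x_i with i in C has exponent at least b i. *)
Lemma radical_component C b : (forall i, i \in C -> (0 < b i)%N) ->
  same_set (radical (irreducible_component C b)) (variable_prime C).
Proof.
move=> b0 f; split=> [[k fk]|fC].
  apply: (prime_exp (k := k) (variable_prime_prime C)) => m /fk [i iC bm].
  by exists i => //; apply: leq_trans bm; apply: b0.
have VC : monomial_ideal (variable_prime C).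
  exists (fun m => exists2 i, i \in C & (0 < m i)%N) => g.
  rewrite monomial_genE; split=> gC m mg.
    by exists m; split; [apply: gC|apply: lepm_refl].
  have [a [[i iC ai] /mnm_lepP am]] := gC m mg.
  by exists i => //; apply: leq_trans ai (am i).
exists (\sum_(i in C) b i).+1 => m.
have : ideal_pow (variable_prime C) (\sum_(i in C) b i).+1
    (f ^+ (\sum_(i in C) b i).+1).
  apply: mem_ideal_gen; exists (fun=> f); split=> //.
  by rewrite prodr_const card_ord.
move/ideal_powE => /(_ VC) fpow /fpow [t [szt tC le_t]].
apply/exists_inP; apply: contraT; rewrite negb_exists_in => /forall_inP lt_b.
have : (size t <= \sum_(i in C) \sum_(h <- t) h i)%N.
  rewrite exchange_big /= -[size t]muln1; apply: sum_ge_size => h /tC.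
  by move=> /variable_prime_monomial [i iC hi]; rewrite (bigD1 i) //= ltn_addr.
rewrite szt leqNgt ltnS leq_sum // => i /lt_b; rewrite -ltnNge => /ltnW.
exact: leq_trans.
Qed.

End Decomposition.

(** * Minimal primes and symbolic powers *)

Section Symbolic.
Variables (K : fieldType) (n : nat) (I : {mpoly K[n]} -> Prop).
Variables (r : nat) (C : 'I_r -> {set 'I_n}) (b : 'I_r -> 'I_n -> nat).
Hypothesis I_monomial : monomial_ideal I.
Hypothesis b_gt0 : forall j i, i \in C j -> (0 < b j i)%N.
Hypothesis IE : forall f, I f <-> forall j, irreducible_component (C j) (b j) f.
Implicit Types (m g h : 'X_{1..n}) (P : {mpoly K[n]} -> Prop).

Lemma mem_monomial m :
  I 'X_[m] <-> forall j, exists2 i, i \in C j & (b j i <= m i)%N.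
Proof.
by rewrite IE; split=> mI j; apply/irreducible_componentX.
Qed.

Lemma sub_variable_prime j : subset_of I (variable_prime (C j)).
Proof.
move=> f /IE /(_ j) fj m /fj [i iC le_b]; exists i => //.
by apply: leq_trans le_b; apply: b_gt0.
Qed.

(** Otherwise each C_j contains a variable outside P. The product of suitable powers of
    these variables lies in every component, hence in I and in P, which is absurd.
    So P contains the ideal of some C_j, which contains I; minimality concludes. *)
Lemma minimal_prime_variables P : minimal_prime I P ->
  exists j, same_set (variable_prime (C j)) P.
Proof.
move=> [Pprime IP minP].
suff [j PC] : exists j, forall i, i \in C j -> P 'X_i.
  exists j; apply: minP; [exact: variable_prime_prime|exact: sub_variable_prime|].
  exact: variable_prime_sub.
apply: NNPP => no.
have /fin_all_exists2 [v vC vP] : forall j, exists2 i, i \in C j & ~ P 'X_i.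
  move=> j; apply: NNPP => noi; apply: no; exists j => i iC.
  by apply: NNPP => Pi; apply: noi; exists i.
have : P (\prod_j 'X_(v j) ^+ b j (v j)).
  apply: IP; rewrite mprodXnE; apply/mem_monomial => j; exists (v j) => //.
  by rewrite mnm_sumE (bigD1 j) //= mulmnE mnm1E eqxx mul1n leq_addr.
by move/(prime_prod Pprime) => [j _ /(prime_exp Pprime)]; apply: vP.
Qed.

Section Antichain.
Hypothesis no_embedded : no_embedded_primes I.
Hypothesis irredundant : forall j, ~ same_set I
  (fun f => forall i, i != j -> irreducible_component (C i) (b i) f).
Hypothesis distinct : forall i j, i != j ->
  ~ same_set (radical (irreducible_component (K := K) (C i) (b i)))
             (radical (irreducible_component (C j) (b j))).

(** By irredundancy some monomial x^m lies in all components but the j-th. Raise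
    its exponents in C_j to b_j i - 1: then multiplying it by any
    variable of C_j brings it into I, and the annihilator of its class is generated
    by these variables. *)
Lemma associated_variable_prime j : associated_prime I (variable_prime (C j)).
Proof.
split; first exact: variable_prime_prime.
have [m [mQ nQ]] : exists m, (forall k, k != j ->
    exists2 i, i \in C k & (b k i <= m i)%N) /\
    forall i, i \in C j -> (m i < b j i)%N.
  apply: NNPP => no; apply: (irredundant (j := j)) => f.
  rewrite IE; split=> [fQ k _|fQ k]; first exact: fQ.
  have [->|] := eqVneq k j; last exact: fQ.
  move=> m mf; apply: NNPP => nom; apply: no; exists m; split=> [i ij|i iC].
    exact: fQ.
  by rewrite ltnNge; apply/negP => le_b; apply: nom; exists i.
pose m' := [multinom (if i \in C j then (b j i).-1 else m i) | i < n].
have m'E i : m' i = if i \in C j then (b j i).-1 else m i by rewrite mnmE.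
have le_mm' i : (m i <= m' i)%N.
  by rewrite m'E; case: ifP => // /nQ; case: (b j i).
exists 'X_[m'] => g; split=> [gC|gI m1 m1g].
  apply/IE => k m1; rewrite (perm_mem (msuppMX _ _)) => /mapP [m2 m2g ->].
  have [->|kj] := eqVneq k j.
    have [i iC m2i] := gC m2 m2g; exists i => //.
    have := b_gt0 iC; rewrite mnmDE m'E iC.
    by lia.
  have [i iC le_b] := mQ k kj; exists i => //.
  by rewrite mnmDE (leq_trans le_b) // (leq_trans (le_mm' i)) // leq_addr.
have m1m' : (m1 + m')%MM \in msupp (g * 'X_[m']).
  by rewrite (perm_mem (msuppMX _ _)) addmC map_f.
have /IE/(_ j _ m1m') [i iC] := gI.
by rewrite mnmDE m'E iC; exists i => //; have := b_gt0 iC; lia.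
Qed.

(** If C_k is contained in C_j, the associated prime of C_j contains that of C_k,
    and is minimal as there are no embedded primes; so the radicals coincide. *)
Lemma components_antichain j k : C k \subset C j -> k = j.
Proof.
move=> CkCj; apply: NNPP => /eqP kj; apply: (distinct kj).
have [_ _ minj] := no_embedded (associated_variable_prime j).
have same : same_set (variable_prime (K := K) (C k)) (variable_prime (C j)).
  apply: minj; [exact: variable_prime_prime|exact: sub_variable_prime|].
  by move=> f fC m /fC [i iC mi]; exists i => //; apply: (subsetP CkCj).
move=> f; rewrite (radical_component (@b_gt0 k)) (radical_component (@b_gt0 j)).
exact: same.
Qed.

End Antichain.

Section Exchange.
Hypothesis antichain : forall j k, C k \subset C j -> k = j.
Hypothesis I_Simis : Simis I.

(** Greedy extraction: m is a multiple of a product of s powers x_i^(c i), i in A. *)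
Lemma floor_sum_decompose (A : {set 'I_n}) (c : 'I_n -> nat) m s :
  (forall i, i \in A -> 0 < c i)%N -> (s <= \sum_(i in A) m i %/ c i)%N ->
  exists t : seq 'I_n, [/\ size t = s, forall i, i \in t -> i \in A &
    forall i, (\sum_(k <- t) (k == i) * c k <= m i)%N].
Proof.
move=> c0; elim: s m => [|s IH] m.
  by exists [::]; split=> // i; rewrite big_nil.
move=> lt_s.
have [i iA mi] : exists2 i, i \in A & (c i <= m i)%N.
  apply: NNPP => no; move: lt_s; rewrite big1 // => i iA; rewrite divn_small //.
  by rewrite ltnNge; apply/negP => le_c; apply: no; exists i.
pose m' := (m - U_(i) *+ c i)%MM.
have m'E k : m' k = (m k - (i == k) * c i)%N by rewrite mnmBE mulmnE mnm1E.
have [|t [szt tA le_t]] := IH m'.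
  move: lt_s; rewrite (bigD1 i) //= [in X in _ -> X](bigD1 i) //=.
  rewrite (eq_bigr (fun k => (m' k %/ c k)%N)); last first.
    by move=> k /andP [_ ki]; rewrite m'E eq_sym (negbTE ki) mul0n subn0.
  rewrite m'E eqxx mul1n -{1}(subnK mi) divnDr ?dvdnn // divnn c0 //.
  by rewrite addn1 addSn.
exists (i :: t); split=> [|k|k]; rewrite /= ?szt //.
  by rewrite inE => /orP [/eqP->|/tA].
rewrite big_cons; have := le_t k; rewrite m'E; case: (eqVneq i k) => [<-|_].
  by rewrite mul1n; lia.
by rewrite mul0n subn0.
Qed.

(** At the minimal prime of C_j the variables outside C_j are units. After
    multiplication by a high power of them, x^m is a multiple of a product of s
    monomials x_i^(b_j i) * (product of the x_k^B, k outside C_j). Each of these is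
    in I: for l <> j, C_l is not contained in C_j, so it contains such a k. *)
Lemma symbolic_power_monomial m s :
  (forall j, s <= \sum_(i in C j) m i %/ b j i)%N -> symbolic_power I s 'X_[m].
Proof.
move=> le_s P Pmin; have [j PE] := minimal_prime_variables Pmin.
have [Pprime _ _] := Pmin.
apply/extension_tofrac => //; first exact: ideal_gen_ideal.
pose B := (\sum_j \sum_i b j i)%N.
pose u := [multinom (if i \in C j then 0 else s * B)%N | i < n].
have uE i : u i = (if i \in C j then 0 else s * B)%N by rewrite mnmE.
exists 'X_[u].
  by move/PE/variable_prime_monomial => [i iC]; rewrite uE iC.
rewrite -mpolyXD; apply/ideal_powE => //; apply/monomials_inX.
have [|t [szt tC le_t]] := floor_sum_decompose _ (le_s j); first exact: b_gt0.
pose F (k : 'I_n) := [multinom (if i \in C j then (k == i) * b j k else B)%N | i < n].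
have FE k i : F k i = (if i \in C j then (k == i) * b j k else B)%N by rewrite mnmE.
exists [seq F k | k <- t]; split=> [|h|i]; first by rewrite size_map.
  case/mapP => k /tC kC ->; apply/mem_monomial => l.
  have [->|lj] := eqVneq l j.
    by exists k => //; rewrite FE kC eqxx mul1n.
  have /subsetPn [i il ij] : ~~ (C l \subset C j).
    by apply: contra lj => /antichain ->.
  exists i => //; rewrite FE (negbTE ij).
  by rewrite /B (bigD1 l) //= (bigD1 i) //= -addnA leq_addr.
rewrite big_map mnmDE uE; under eq_bigr => k _ do rewrite FE.
case: ifP => iC; first by rewrite add0n; apply: le_t.
by rewrite big_const_seq count_predT iter_addn_0 szt mulnC leq_addr.
Qed.

Lemma Simis_monomial m s : (0 < s)%N ->
  (forall j, s <= \sum_(i in C j) m i %/ b j i)%N -> sum_of_monomials I s m.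
Proof.
move=> s0 /symbolic_power_monomial /(I_Simis s0) /ideal_powE mI.
exact/monomials_inX/mI.
Qed.

End Exchange.
End Symbolic.

(** * The exchange property of Simis ideals *)

Section ExchangeOfGenerators.
Variables (K : fieldType) (n : nat) (I : {mpoly K[n]} -> Prop).
Variables (r : nat) (C : 'I_r -> {set 'I_n}) (b : 'I_r -> 'I_n -> nat).
Hypothesis I_monomial : monomial_ideal I.
Hypothesis b_gt0 : forall j i, i \in C j -> (0 < b j i)%N.
Hypothesis IE : forall f, I f <-> forall j, irreducible_component (C j) (b j) f.
Hypothesis antichain : forall j k, C k \subset C j -> k = j.
Hypothesis I_Simis : Simis I.
Implicit Types (m g h : 'X_{1..n}).
Local Open Scope nat_scope.

Let memI := mem_monomial IE.

(* N clears all the denominators b j i, and c j i is N / b j i. *)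
Let N := \prod_j \prod_i maxn 1 (b j i).
Let c j i := N %/ b j i.

Let N_gt0 : 0 < N.
Proof. by rewrite !prodn_gt0 // => j; rewrite prodn_gt0 // => i; rewrite leq_max. Qed.

Let cb j i : i \in C j -> c j i * b j i = N.
Proof.
move=> iC; rewrite divnK // /N (bigD1 j) //= (bigD1 i) //=.
by rewrite (maxn_idPr (b_gt0 iC)) -mulnA dvdn_mulr.
Qed.

Let c_gt0 j i : i \in C j -> 0 < c j i.
Proof. by move=> iC; have := N_gt0; rewrite -(cb iC) muln_gt0 => /andP []. Qed.

Lemma component_cost_ge j g : I 'X_[g] -> N <= \sum_(i in C j) c j i * g i.
Proof.
move=> /memI /(_ j) [i iC le_b]; rewrite (bigD1 i) //= -(cb iC).
by rewrite (leq_trans _ (leq_addr _ _)) // leq_mul2l le_b orbT.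
Qed.

(** The witness i of membership already contributes N. In case of equality the
    other terms vanish, and l is that witness because g l > 0. *)
Lemma component_cost_tight j g l : I 'X_[g] ->
  \sum_(i in C j) c j i * g i <= N -> l \in C j -> 0 < g l ->
  g l = b j l /\ forall k, k \in C j -> k != l -> g k = 0.
Proof.
move=> /memI /(_ j) [i iC le_b]; rewrite (bigD1 i) //= -(cb iC) => le_N lC gl.
have c0 := c_gt0 iC.
have rest0 : \sum_(k in C j | k != i) c j k * g k = 0.
  apply/eqP; rewrite -leqn0 -(leq_add2l (c j i * g i)) addn0.
  by rewrite (leq_trans le_N) // leq_mul2l le_b orbT.
have zero k : k \in C j -> k != i -> g k = 0.
  move=> kC ki; move/eqP: rest0; rewrite sum_nat_eq0 => /forallP /(_ k).
  by rewrite kC ki /= muln_eq0 eqn0Ngt c_gt0 //= => /eqP.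
have -> : l = i.
  by apply/eqP; apply: contraTT gl => li; rewrite zero.
split=> //; apply/eqP; rewrite eqn_leq le_b andbT -(leq_pmul2l c0).
by move: le_N; rewrite rest0 addn0.
Qed.

(** For x^m = x^(N (g + g')) / x_l each sum of integer parts is at least 2N: the
    division by x_l costs 1, and only where l is in C_j; there the sum
    for x^(N (g + g')) exceeds 2N, as the component is not tight at both. *)
Lemma Simis_exchange : exchange_property (min_gens I).
Proof.
move=> g g' l Gg Gg' lg lg' alt.
have [[Ig _] [Ig' _]] := ((min_gensP g I_monomial).1 Gg, (min_gensP g' I_monomial).1 Gg').
pose m := [multinom (N * (g i + g' i) - (i == l))%N | i < n].
have mE i : m i = N * (g i + g' i) - (i == l) by rewrite mnmE.
have gl : 0 < g l by rewrite -in_mnm_supp.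
have gl' : 0 < g' l by rewrite -in_mnm_supp.
have le_floor j i : i \in C j -> c j i * (g i + g' i) <= m i %/ b j i + (i == l).
  move=> iC; rewrite [leqRHS]addnC -leq_subLR leq_divRL ?b_gt0 // mE -(cb iC) mulnBl.
  case: (i == l); last by rewrite mul0n !subn0; lia.
  by rewrite mul1n; have := b_gt0 iC; nia.
have cost j : N + N + (l \in C j) <= \sum_(i in C j) c j i * (g i + g' i).
  under eq_bigr => i _ do rewrite mulnDr.
  rewrite big_split /=.
  have le_g := component_cost_ge j Ig; have le_g' := component_cost_ge j Ig'.
  case: (boolP (l \in C j)) => [lC|_]; last by rewrite addn0 leq_add.
  rewrite addn1; case: (leqP (\sum_(i in C j) c j i * g i) N) => [tight|lt_g].
    case: (leqP (\sum_(i in C j) c j i * g' i) N) => [tight'|lt_g'].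
      exfalso.
      have [gl_b zero] := component_cost_tight Ig tight lC gl.
      have [gl_b' _] := component_cost_tight Ig' tight' lC gl'.
      case: alt => [|[h [Gh /subsetP hg ltl]]]; first by rewrite gl_b gl_b'.
      have [/memI /(_ j) [k kC le_b] _] := (min_gensP h I_monomial).1 Gh.
      have kl : k != l by apply: contraTneq ltl => ekl; rewrite -leqNgt gl_b -ekl.
      have hk : 0 < h k by apply: leq_trans le_b; apply: b_gt0.
      have : k \in mnm_supp g by apply: hg; rewrite in_mnm_supp.
      by rewrite in_mnm_supp zero.
    by rewrite -addnS leq_add.
  by rewrite -addSn leq_add.
have [|j|t [szt tI le_t]] := @Simis_monomial _ _ I r C b I_monomial b_gt0 IE antichain
    I_Simis m (N + N).
- by rewrite addn_gt0 N_gt0.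
- have sum_l : \sum_(i in C j) (i == l) = (l \in C j).
    case: (boolP (l \in C j)) => [lC|lC].
      by rewrite (bigD1 l) //= eqxx big1 // => i /andP [_ /negbTE->].
    by rewrite big1 // => i iC; case: eqP => // il; move: lC; rewrite -il iC.
  have : \sum_(i in C j) c j i * (g i + g' i) <=
      \sum_(i in C j) (m i %/ b j i + (i == l)).
    by apply: leq_sum => i; apply: le_floor.
  by rewrite big_split /= sum_l => /(leq_trans (cost j)); rewrite leq_add2r.
have [t' [szt' t'G le_t']] : exists t', [/\ size t' = size t,
    forall h, h \in t' -> min_gens I h &
    forall i, \sum_(h <- t') h i <= \sum_(h <- t) h i].
  elim: t tI {szt le_t} => [|h t IH] tI; first by exists [::].
  have [|t' [szt' t'G le_t']] := IH.
    by move=> k kt; apply: tI; rewrite inE kt orbT.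
  have [k Gk /mnm_lepP kh] := min_gens_below I_monomial (tI h (mem_head _ _)).
  exists (k :: t'); split=> [|x|i]; first by rewrite /= szt'.
    by rewrite inE => /orP [/eqP->|/t'G].
  by rewrite !big_cons leq_add.
exists N, t'; split=> // [|i]; first by rewrite szt' szt.
have := leq_trans (le_t' i) (le_t i); rewrite mE.
case: (eqVneq i l) => [->|_]; last by rewrite subn0 addn0.
by rewrite -(leq_add2r 1) subnK // muln_gt0 N_gt0 addn_gt0 gl.
Qed.

(** Lowering an exponent that exceeds all the b j i does not leave I. *)
Lemma finite_min_gens :
  exists s : seq 'X_{1..n}, forall g, min_gens I g -> g \in s.
Proof.
pose B := \sum_j \sum_i b j i.
exists [seq [multinom (f i : nat) | i < n] | f : {ffun 'I_n -> 'I_B.+1}].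
move=> g /(min_gensP _ I_monomial) [Ig ming].
have gB i : g i <= B.
  have /mnmP/(_ i) <- : [multinom minn (g k) B | k < n] = g.
    apply: ming; last by apply/mnm_lepP => k; rewrite mnmE geq_minl.
    apply/memI => j; have /memI/(_ j) [k kC le_b] := Ig; exists k => //.
    rewrite mnmE leq_min le_b /B (bigD1 j) //= (bigD1 k) //= -addnA.
    exact: leq_addr.
  by rewrite mnmE geq_minr.
apply/imageP; exists [ffun i => inord (g i)] => //.
by apply/mnmP => i; rewrite mnmE ffunE inordK // ltnS.
Qed.

End ExchangeOfGenerators.

(** * The weighted square-free ideal *)

Section Weights.
Variables (K : fieldType) (n : nat) (w : 'I_n -> nat).
Hypothesis w_gt0 : forall i, (0 < w i)%N.
Implicit Types (m g a : 'X_{1..n}) (f : {mpoly K[n]}).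

Definition scale_mnm m : 'X_{1..n} := [multinom (w i * m i)%N | i < n].

Lemma scale_mnm_inj : injective scale_mnm.
Proof.
move=> m m' /mnmP eq; apply/mnmP => i; have := eq i; rewrite !mnmE.
by move/eqP; rewrite eqn_pmul2l // => /eqP.
Qed.

(** This endomorphism maps distinct monomials to distinct monomials, so no
    cancellation occurs and supports can be read off. *)
Definition scale_poly (f : {mpoly K[n]}) : {mpoly K[n]} :=
  f \mPo [tuple 'X_i ^+ w i | i < n].

Lemma scale_polyE f :
  scale_poly f = \sum_(m <- msupp f) f@_m *: 'X_[scale_mnm m].
Proof.
rewrite /scale_poly comp_mpolyEX; apply: eq_bigr => m _; congr (_ *: _).
rewrite comp_mpolyX [RHS]mpolyXE_id; apply: eq_bigr => i _.
by rewrite tnth_mktuple mnmE exprM.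
Qed.

Lemma mcoeff_scale f m : (scale_poly f)@_(scale_mnm m) = f@_m.
Proof.
rewrite scale_polyE raddf_sum /=.
have term k : (f@_k *: 'X_[scale_mnm k])@_(scale_mnm m) = f@_k * (k == m)%:R.
  by rewrite mcoeffZ mcoeffX (inj_eq scale_mnm_inj).
rewrite (eq_bigr _ (fun k _ => term k)).
have [mf|mf] := boolP (m \in msupp f).
  rewrite (bigD1_seq m) ?msupp_uniq //= eqxx mulr1 big1 ?addr0 // => k.
  by move=> /negbTE->; rewrite mulr0.
rewrite (memN_msupp_eq0 mf) big_seq big1 // => k kf; case: eqP => [km|].
  by move: mf; rewrite -km kf.
by rewrite mulr0.
Qed.

Lemma msupp_scale f m : (scale_mnm m \in msupp (scale_poly f)) = (m \in msupp f).
Proof. by rewrite !mcoeff_msupp mcoeff_scale. Qed.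

Lemma scale_notin_variable_prime (C : {set 'I_n}) f :
  variable_prime C (scale_poly f) -> variable_prime C f.
Proof.
move=> fC m; rewrite -msupp_scale => /fC [i iC]; rewrite mnmE.
by rewrite muln_gt0 => /andP [_ mi]; exists i.
Qed.

Variable I : {mpoly K[n]} -> Prop.
Hypothesis I_monomial : monomial_ideal I.
Hypothesis gens_w : forall g i, min_gens I g -> (0 < g i)%N -> g i = w i.
Hypothesis gens_antichain : support_antichain (min_gens I).

Definition indicator g : 'X_{1..n} := [multinom ((0 < g i)%N : nat) | i < n].

Definition support_ideal : {mpoly K[n]} -> Prop :=
  monomial_gen (fun m => exists2 g, min_gens I g & m = indicator g).

Lemma support_ideal_monomial : monomial_ideal support_ideal.
Proof. by exists (fun m => exists2 g, min_gens I g & m = indicator g). Qed.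

Lemma scale_indicator g : min_gens I g -> scale_mnm (indicator g) = g.
Proof.
move=> Gg; apply/mnmP => i; rewrite !mnmE.
by case: (posnP (g i)) => [->|gi]; rewrite ?muln0 // (gens_w Gg gi) muln1.
Qed.

Lemma mem_support_ideal m :
  support_ideal 'X_[m] <-> exists2 g, min_gens I g & (indicator g <= m)%MM.
Proof.
rewrite /support_ideal monomial_genE monomials_inX; split.
  by case=> _ [[g Gg ->] le_m]; exists g.
by case=> g Gg le_m; exists (indicator g); split=> //; exists g.
Qed.

Lemma min_gens_support_ideal a :
  min_gens support_ideal a <-> exists2 g, min_gens I g & a = indicator g.
Proof.
rewrite (min_gensP a support_ideal_monomial); split.
  case=> /mem_support_ideal [g Gg le_a] mina; exists g => //.
  by apply/esym/mina => //; apply/mem_support_ideal; exists g => //; apply: lepm_refl.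
case=> g Gg ->; split.
  by apply/mem_support_ideal; exists g => //; apply: lepm_refl.
move=> m /mem_support_ideal [h Gh /mnm_lepP hm] /mnm_lepP mg.
have hg : mnm_supp h = mnm_supp g.
  apply: gens_antichain => //; apply/subsetP => i; rewrite !in_mnm_supp => hi.
  by have := leq_trans (hm i) (mg i); rewrite !mnmE hi lt0b.
apply/mnmP => i; apply/eqP; rewrite eqn_leq mg /=; apply: leq_trans (hm i).
by rewrite !mnmE -!in_mnm_supp hg.
Qed.

Lemma support_ideal_squarefree : squarefree_monomial_ideal support_ideal.
Proof.
split=> [|a /min_gens_support_ideal [g _ ->] i]; first exact: support_ideal_monomial.
by rewrite mnmE leq_b1.
Qed.

Lemma support_ideal_weighted : same_set I (weighted_ideal w support_ideal).
Proof.
have [_ Iup IE] := monomial_idealP I_monomial => f.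
rewrite IE /weighted_ideal monomial_genE; split=> fI m mf.
  have [g Gg gm] := min_gens_below I_monomial (fI m mf); exists g; split=> //.
  exists (indicator g); split; first by apply/min_gens_support_ideal; exists g.
  by rewrite -[LHS]scale_indicator.
have [_ [[_ [/min_gens_support_ideal [g Gg ->] ->]] gm]] := fI m mf.
apply: Iup gm; rewrite -/(scale_mnm _) scale_indicator //.
by have [] := (min_gensP g I_monomial).1 Gg.
Qed.

Lemma scale_support_ideal m : support_ideal 'X_[m] -> I 'X_[scale_mnm m].
Proof.
have [_ Iup _] := monomial_idealP I_monomial.
move=> /mem_support_ideal [g Gg /mnm_lepP gm].
have [Ig _] := (min_gensP g I_monomial).1 Gg; apply: Iup Ig _.
apply/mnm_lepP => i; rewrite -(scale_indicator Gg) !mnmE.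
by rewrite leq_mul2l orbC; have := gm i; rewrite mnmE => ->.
Qed.

(** The two ideals have the same radical. *)
Lemma prime_over_support_ideal P : prime_ideal P ->
  subset_of I P <-> subset_of support_ideal P.
Proof.
move=> Pprime; have [idP _ _] := Pprime; have [_ _ PM] := idP.
have [_ _ IE] := monomial_idealP I_monomial.
split=> [IP f fJ|JP f /IE fI]; apply: ideal_monomials => // m mf.
  have Jm : support_ideal 'X_[m].
    have [_ _ JE] := monomial_idealP support_ideal_monomial.
    by move/JE: fJ; apply.
  have := IP _ (scale_support_ideal Jm).
  pose B := (\sum_i w i)%N => Pm.
  apply: (prime_exp (k := B) Pprime); rewrite mpolyXn.
  have le_m : (scale_mnm m <= m *+ B)%MM.
    apply/mnm_lepP => i; rewrite mnmE mulmnE mulnC leq_mul2l.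
    by rewrite /B (bigD1 i) //= leq_addr orbT.
  by rewrite -(submK le_m) mpolyXD; apply: PM.
have [g Gg gm] := min_gens_below I_monomial (fI m mf).
apply: JP; apply/mem_support_ideal; exists g => //.
apply/mnm_lepP => i; rewrite mnmE; apply: leq_trans (mnm_lepP gm i).
by case: (g i).
Qed.

Lemma minimal_prime_support_ideal P :
  minimal_prime I P -> minimal_prime support_ideal P.
Proof.
case=> Pprime IP minP; split=> // [|Q Qprime JQ QP].
  exact/prime_over_support_ideal.
by apply: minP => //; apply/prime_over_support_ideal.
Qed.

Hypothesis minimal_primes : forall P, minimal_prime I P ->
  exists C : {set 'I_n}, same_set (variable_prime C) P.
Hypothesis I_Simis : Simis I.

Lemma scale_ideal_pow s f :
  ideal_pow support_ideal s f -> ideal_pow I s (scale_poly f).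
Proof.
move=> /(ideal_powE s f support_ideal_monomial) fJ.
rewrite scale_polyE; apply: ideal_sum => [|m mf]; first exact: ideal_gen_ideal.
have [_ _ mul] : is_ideal (ideal_pow I s) by apply: ideal_gen_ideal.
rewrite -mul_mpolyC; apply/mul/(ideal_powE s _ I_monomial)/monomials_inX.
have [t [szt tJ le_t]] := fJ m mf.
exists [seq scale_mnm h | h <- t]; split=> [|_ /mapP [h ht ->]|i].
- by rewrite size_map.
- exact/scale_support_ideal/tJ.
- rewrite big_map mnmE; under eq_bigr => h _ do rewrite mnmE.
  by rewrite -big_distrr leq_mul2l le_t orbT.
Qed.

Lemma unscale_ideal_pow s f :
  ideal_pow I s (scale_poly f) -> ideal_pow support_ideal s f.
Proof.
move=> /(ideal_powE s _ I_monomial) fI.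
apply/(ideal_powE s f support_ideal_monomial) => m.
rewrite -msupp_scale => /fI [t [szt tI le_t]].
have [t' [szt' t'J le_t']] : exists t' : seq 'X_{1..n}, [/\ size t' = size t,
    forall h, h \in t' -> support_ideal 'X_[h] &
    forall i, (w i * \sum_(h <- t') h i <= \sum_(h <- t) h i)%N].
  elim: t tI {szt le_t} => [|h t IH] tI.
    by exists [::]; split=> // i; rewrite !big_nil muln0.
  have [|t' [szt' t'J le_t']] := IH.
    by move=> k kt; apply: tI; rewrite inE kt orbT.
  have [g Gg /mnm_lepP gh] := min_gens_below I_monomial (tI h (mem_head _ _)).
  exists (indicator g :: t'); split=> [|x|i]; first by rewrite /= szt'.
    rewrite inE => /orP [/eqP->|/t'J //].
    by apply/mem_support_ideal; exists g => //; apply: lepm_refl.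
  rewrite !big_cons mulnDr leq_add //; apply: leq_trans (gh i).
  by have /mnmP/(_ i) := scale_indicator Gg; rewrite mnmE => ->.
exists t'; split=> // [|i]; first by rewrite szt'.
have := leq_trans (le_t' i) (le_t i).
by rewrite mnmE leq_pmul2l.
Qed.

(** A minimal prime P of I is a minimal prime of J. If u f is in J^s with u outside
    P, the substitution gives u', f' with u' f' in I^s, and u' is outside P since P is
    generated by variables. So f' is in the symbolic power of I, hence in I^s,
    and the exponents can be divided by w again. *)
Lemma support_ideal_Simis : Simis support_ideal.
Proof.
move=> s s0 f; split; last exact: pow_sub_symbolic.
move=> fJ; apply/unscale_ideal_pow/(I_Simis s0) => P Pmin.
have [Pprime _ _] := Pmin; have [C PE] := minimal_primes Pmin.
have /(extension_tofrac Pprime (ideal_gen_ideal _)) [u Pu ufJ] :=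
  fJ P (minimal_prime_support_ideal Pmin).
apply/(extension_tofrac Pprime (ideal_gen_ideal _)); exists (scale_poly u).
  by move/PE/scale_notin_variable_prime/PE.
by rewrite /scale_poly -rmorphM; apply: scale_ideal_pow.
Qed.

End Weights.

(** In both cases the supports of the generators form an antichain: as facets of a
    complex, or because they all have three elements. *)
Lemma generators_consistent (K : fieldType) (n : nat) (I : {mpoly K[n]} -> Prop) :
  monomial_ideal I ->
  (same_set (gen_supports I) (gen_supports (radical I)) /\
     exists D : {set {set 'I_n}}, is_Delta I D /\ simplicial_forest D)
    \/ support3_ideal I ->
  exchange_property (min_gens I) ->
  (exists s : seq 'X_{1..n}, forall g, min_gens I g -> g \in s) ->
  support_antichain (min_gens I) /\
  forall g g' l, min_gens I g -> min_gens I g' ->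
    l \in mnm_supp g -> l \in mnm_supp g' -> g l = g' l.
Proof.
move=> Imon cases exch fin.
have minimal : divisibility_antichain (min_gens I).
  move=> g h /(min_gensP _ Imon) [Ig _] /(min_gensP _ Imon) [_ minh] gh.
  exact: minh.
case: cases => [[_ [D [[_ facE] forest]]]|[_ three]].
  have anti : support_antichain (min_gens I).
    move=> g h Gg Gh gh.
    have /facetP [_ maxg] : mnm_supp g \in facets D by apply/facE; exists g.
    have /facetP [hD _] : mnm_supp h \in facets D by apply/facE; exists h.
    by rewrite (maxg _ hD gh).
  split=> //; apply: forest_consistent => // E F [g Gg ->] [h Gh ->] ne.
  have toF H : (exists2 g, min_gens I g & H = mnm_supp g) <-> H \in facets D.
    by rewrite facE; split=> [[k Gk ->]|[k [Gk ->]]]; exists k.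
  have [||L [LD LU alt]] := forest_leaf_property forest _ _ ne.
  - by apply/toF; exists g.
  - by apply/toF; exists h.
  exists L; split=> //; first exact/toF.
  case: alt => [all_L|[J [JD JU JL JP]]]; [left|right].
    by move=> H /toF; apply: all_L.
  by exists J; split=> // [|H /toF]; [apply/toF|apply: JP].
have card3 g : min_gens I g -> #|mnm_supp g| = 3.
  case/three => i [j [k [a [b [c [uniq_ijk /and3P [a0 b0 c0] ->]]]]]].
  transitivity #|[:: i; j; k]|; last exact/card_uniqP.
  apply: eq_card => l.
  rewrite in_mnm_supp !mnmDE !mulmnE !mnm1E !inE ![l == _]eq_sym.
  by case: (i == l); case: (j == l); case: (k == l);
    rewrite ?mul1n ?mul0n ?addn0 ?add0n ?addn_gt0 ?a0 ?b0 ?c0 ?orbT.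
have anti : support_antichain (min_gens I).
  by move=> g h Gg Gh gh; apply/eqP; rewrite eqEcard gh !card3.
by split=> //; apply: support_three_consistent.
Qed.

Local Close Scope ring_scope.

Theorem mainTheorem1 (K : fieldType) (n : nat) (I : {mpoly K[n]} -> Prop)
  (I_monomial : monomial_ideal I)
  (I_cases :
    (same_set (gen_supports I) (gen_supports (radical I)) /\
     exists D : {set {set 'I_n}}, is_Delta I D /\ simplicial_forest D)
    \/ support3_ideal I)
  (I_noembedded : no_embedded_primes I)
  (I_irrdec : minimal_irreducible_decomposition I)
  (I_Simis : Simis I) :
  exists (J : {mpoly K[n]} -> Prop) (w : 'I_n -> nat),
    [/\ squarefree_monomial_ideal J, Simis J,
        forall i, (1 <= w i)%N & same_set I (weighted_ideal w J)].
Proof.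
have [r [Q [[Qirr IQ irredundant] distinct]]] := I_irrdec.
have /fin_all_exists [Cb CbP] := fun j => irreducible_componentE (Qirr j).
pose C j := (Cb j).1; pose b j := (Cb j).2.
have b_gt0 j i : i \in C j -> 0 < b j i by have [b0 _] := CbP j; apply: b0.
have QE j : same_set (Q j) (irreducible_component (C j) (b j)) by have [] := CbP j.
have IE f : I f <-> forall j, irreducible_component (C j) (b j) f.
  by rewrite IQ; split=> fQ j; apply/QE.
have radE j f : radical (Q j) f <-> radical (irreducible_component (C j) (b j)) f.
  by split=> -[k /QE]; exists k.
have antichain : forall j k, C k \subset C j -> k = j.
  apply: (components_antichain b_gt0 IE I_noembedded) => [j sameI|i j ij same].
    apply: (irredundant j) => f; rewrite sameI.
    by split=> fQ i /fQ /QE.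
  by apply: (distinct i j ij) => f; rewrite !radE.
have exch := Simis_exchange I_monomial b_gt0 IE antichain I_Simis.
have fin := finite_min_gens I_monomial IE.
have [anti consistent] := generators_consistent I_monomial I_cases exch fin.
have /fin_all_exists [w wP] : forall i, exists wi, 0 < wi /\
    forall g, min_gens I g -> 0 < g i -> g i = wi.
  move=> i; have [[g [Gg gi]]|no] := classic (exists g, min_gens I g /\ 0 < g i).
    exists (g i); split=> // h Gh hi; apply: consistent => //; by rewrite in_mnm_supp.
  by exists 1; split=> // g Gg gi; case: no; exists g.
have w_gt0 i : 0 < w i by have [] := wP i.
have gens_w g i : min_gens I g -> 0 < g i -> g i = w i.
  by move=> Gg gi; have [_ ->] := wP i.
exists (support_ideal I), w; split=> //.
- exact: support_ideal_squarefree anti.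
- apply: (support_ideal_Simis w_gt0 I_monomial gens_w) => // P Pmin.
  have [j PE] := minimal_prime_variables b_gt0 IE Pmin.
  by exists (C j).
- exact: support_ideal_weighted I_monomial gens_w anti.
Qed.
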